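(* For each of the following four pairs of parameters $\alpha,\beta\in\mathbb{Q}^6$, the associated hypergeometric group $\Gamma(f,g)$ is arithmetic: (1) $\alpha=\left(0,0,0,0,\tfrac12,\tfrac12\right)$, $\beta=\left(\tfrac13,\tfrac13,\tfrac23,\tfrac23,\tfrac16,\tfrac56\right)$; (2) $\alpha=\left(0,0,0,0,\tfrac13,\tfrac23\right)$, $\beta=\left(\tfrac19,\tfrac29,\tfrac49,\tfrac59,\tfrac79,\tfrac89\right)$; (3) $\alpha=\left(0,0,\tfrac14,\tfrac14,\tfrac34,\tfrac34\right)$, $\beta=\left(\tfrac13,\tfrac23,\tfrac1{12},\tfrac5{12},\tfrac7{12},\tfrac{11}{12}\right)$; (4) $\alpha=\left(0,0,\tfrac1{12},\tfrac5{12},\tfrac7{12},\tfrac{11}{12}\right)$, $\beta=\left(\tfrac13,\tfrac23,\tfrac14,\tfrac34,\tfrac14,\tfrac34\right)$.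
   Context: For $\alpha=(\alpha_1,\dots,\alpha_n)$ and $\beta=(\beta_1,\dots,\beta_n)$ with $\alpha_j-\beta_k\notin\mathbb{Z}$ for all $j,k$, put $f(x)=\prod_{j=1}^n(x-e^{2\pi i\alpha_j})$ and $g(x)=\prod_{j=1}^n(x-e^{2\pi i\beta_j})$. The hypergeometric group $\Gamma(f,g)\subset \mathrm{GL}_n(\mathbb{C})$ associated to $\alpha,\beta$ is the subgroup generated by the companion matrices $A$ of $f$ and $B$ of $g$. Here the companion matrix of $x^n+a_{n-1}x^{n-1}+\cdots+a_1x+a_0$ is the $n\times n$ matrix that sends the standard basis vector $e_i$ to $e_{i+1}$ for $1\le i\le n-1$ and whose last column is $(-a_0,-a_1,\dots,-a_{n-1})^t$. In all cases considered here $n=6$, and $f,g$ are products of cyclotomic polynomials with $f(0)=g(0)=1$, so $\Gamma(f,g)\subset\mathrm{GL}_6(\mathbb{Z})$. Moreover $\Gamma(f,g)$ preserves a non-degenerate integral symplectic form $\Omega$ on $\mathbb{Z}^6$ (unique up to scalar), and its Zariski closure is $\mathrm{Sp}_\Omega$. Definition (arithmetic): let $\mathrm{G}$ be the Zariski closure of $\Gamma(f,g)$ inside $\mathrm{GL}_n(\mathbb{C})$, and let $\mathrm{G}(\mathbb{Z})=\mathrm{G}\cap \mathrm{GL}_n(\mathbb{Z})$. The group $\Gamma(f,g)\subseteq \mathrm{G}(\mathbb{Z})$ is called arithmetic if it has finite index in $\mathrm{G}(\mathbb{Z})$. *)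

(* Defs.v *)
From HB Require Import structures.
From mathcomp Require Import all_boot all_order all_algebra.
From mathcomp Require Import classical_sets cardinality reals trigo.
From mathcomp Require Import complex.
(* Not imported: its notations clash with those of MathComp-Analysis. *)
From mathcomp Require mpoly.

Set Implicit Arguments.
Unset Strict Implicit.
Unset Printing Implicit Defensive.

Import Order.TTheory GRing.Theory Num.Theory.

Local Open Scope classical_set_scope.
Local Open Scope ring_scope.

(* e^(2 pi i a) in C = R[i]. *)
Definition exp2pii (R : realType) (a : rat) : R[i] :=
  let t := 2 * pi * ratr a in Complex (cos t) (sin t).

Definition param_poly (R : realType) (n : nat) (a : n.-tuple rat) : {poly R[i]} :=
  \prod_(j < n) ('X - (exp2pii R (tnth a j))%:P).

(* The matrices of this file act on column vectors. For p monic of degree n,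
   this is the transpose of mxpoly's companionmx p. *)
Definition companion (K : nzRingType) (n : nat) (p : {poly K}) : 'M[K]_n :=
  \matrix_(i < n, j < n)
    if j.+1 == n then - p`_i else ((i : nat) == j.+1)%:R.

Definition GL (K : comUnitRingType) (n : nat) : set 'M[K]_n :=
  [set M | M \in unitmx].

Definition subgroup_GL (K : comUnitRingType) (n : nat) (H : set 'M[K]_n) : Prop :=
  [/\ H `<=` @GL K n, H 1%:M,
      forall M N, H M -> H N -> H (M *m N) &
      forall M, H M -> H (invmx M)].

Definition hypergeometric_group (R : realType) (n : nat)
    (alpha beta : n.-tuple rat) : set 'M[R[i]]_n :=
  smallest (@subgroup_GL R[i] n)
    [set companion n (param_poly R alpha); companion n (param_poly R beta)].
Arguments hypergeometric_group R {n} alpha beta.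

(* Polynomials in the n * n matrix entries, indexed through mxvec. Allowing also
   1 / det would not change the closed subsets of GL_n. *)
Definition zariski_closed (K : fieldType) (n : nat) (X : set 'M[K]_n) : Prop :=
  exists P : set (mpoly.mpoly (n * n) K),
    X = [set M | GL M /\
                 forall p, P p -> mpoly.meval (fun k => mxvec M 0 k) p = 0].

Definition zariski_closure (K : fieldType) (n : nat) (X : set 'M[K]_n) :
    set 'M[K]_n :=
  smallest (@zariski_closed K n) X.

Definition GL_int (K : comUnitRingType) (n : nat) : set 'M[K]_n :=
  [set map_mx intr N | N in @GL int n].

(* The set of left cosets M H, for M in G, is finite. *)
Definition finite_index (K : comUnitRingType) (n : nat) (H G : set 'M[K]_n) : Prop :=
  H `<=` G /\ finite_set [set [set M *m h | h in H] | M in G].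

Definition arithmetic (K : fieldType) (n : nat) (Gamma : set 'M[K]_n) : Prop :=
  finite_index Gamma (zariski_closure Gamma `&` @GL_int K n).

(* Main.v *)
Require Import Defs.
From HB Require Import structures.
From Stdlib Require Import ZArith String Ascii.
From mathcomp Require Import all_boot all_order all_algebra.
From mathcomp Require Import boolp classical_sets cardinality reals trigo.
From mathcomp Require Import complex ring zify ssrZ.
(* The notations of this library clash with those of MathComp-Analysis. *)
From mathcomp Require Import (canonicals) mpoly.

(* Write T_v for the transvection along v. Each group Gamma of the theorem is
   generated by A and the transvection A^-1 B = T_w. Its orbit of w contains
   vectors u and u + k w with u orthogonal to w, and T_(u + k w) T_u^-1 then lies
   in the unipotent radical of the stabilizer of the line of w. Enough such
   elements, and their conjugates by an element moving w to a vector f with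
   <w, f> <> 0, give in a rational symplectic basis e_0 = w, f_0 ~ f, e_1, f_1, ...
   all root elements of some level m attached to e_0 and f_0. By commutators Gamma
   then contains T_v^M for all vectors v of the lattice spanned by the basis, where
   M = 8 m'^4 and m' = 2 m.

   The T_v^M generate a normal subgroup N of the integral symplectic group Sp of
   that lattice. Its index is finite for an elementary reason, which needs neither
   the congruence subgroup property nor primes in arithmetic progressions: a
   unimodular vector is carried to e_0 by a product of three elements taken from
   finitely many Heisenberg groups that are finite modulo N. Hence the T_v with v
   unimodular form finitely many classes modulo N. They generate Sp, they are
   closed under conjugation, and T_v^M is in N, so that Sp / N is finite by
   Dietzmann's lemma. Finally the stabilizer of Z^6 and that of the sublattice are
   commensurable. *)

Set Implicit Arguments.
Unset Strict Implicit.
Unset Printing Implicit Defensive.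
Import Order.TTheory GRing.Theory Num.Theory.
Local Open Scope ring_scope.
(* MathComp takes over the usual key %Z for its type [int]. *)
Delimit Scope Z_scope with BZ.

(** * Transvections *)

Section Transvections.

Variables (n : nat) (J : 'M[int]_n.+1).
Implicit Types (x y v w a b c : 'cV[int]_n.+1) (s t k : int) (g h : 'M[int]_n.+1).

Definition form x y : int := (x^T *m J *m y) 0 0.

Definition transv v s : 'M_n.+1 := 1 + s *: (v *m (v^T *m J)).

(** The polarization of [transv]. For [a] and [b] in different planes of a symplectic basis it is a
    short root element, whereas [transv] gives the long ones. *)
Definition etransv a b s : 'M_n.+1 :=
  1 + s *: (a *m (b^T *m J) + b *m (a^T *m J)).

Definition isometry g := g \is a GRing.unit /\ g^T *m J *m g = J.

Lemma formDl x y v : form (x + y) v = form x v + form y v.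
Proof. by rewrite /form linearD /= !mulmxDl mxE. Qed.

Lemma formDr x y v : form v (x + y) = form v x + form v y.
Proof. by rewrite /form mulmxDr mxE. Qed.

Lemma formZl s x y : form (s *: x) y = s * form x y.
Proof. by rewrite /form linearZ /= -!scalemxAl mxE. Qed.

Lemma formZr s x y : form x (s *: y) = s * form x y.
Proof. by rewrite /form -scalemxAr mxE. Qed.

Lemma formNl x y : form (- x) y = - form x y.
Proof. by rewrite -scaleN1r formZl mulN1r. Qed.

Lemma formNr x y : form x (- y) = - form x y.
Proof. by rewrite -scaleN1r formZr mulN1r. Qed.

Lemma form0l x : form 0 x = 0.
Proof. by rewrite -[0](scale0r x) formZl mul0r. Qed.

Lemma form0r x : form x 0 = 0.
Proof. by rewrite -[0](scale0r x) formZr mul0r. Qed.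

Definition formE := (formDl, formDr, formZl, formZr, formNl, formNr, form0l, form0r).

Lemma mulmx_form a b x : a *m (b^T *m J) *m x = form b x *: a.
Proof.
rewrite -mulmxA [b^T *m J *m x]mx11_scalar mul_mx_scalar.
by congr (_ *: _); rewrite /form.
Qed.

Lemma transvE v s x : transv v s *m x = x + (s * form v x) *: v.
Proof. by rewrite /transv mulmxDl mul1mx -scalemxAl mulmx_form scalerA. Qed.

Lemma etransvE a b s x :
  etransv a b s *m x = x + (s * form b x) *: a + (s * form a x) *: b.
Proof.
rewrite /etransv mulmxDl mul1mx -scalemxAl mulmxDl !mulmx_form scalerDr.
by rewrite !scalerA addrA.
Qed.

Lemma mx_ext g h : (forall x, g *m x = h *m x) -> g = h.
Proof.
by move=> gh; apply/matrixP => i j; have /colP/(_ i) := gh (delta_mx j 0);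
   rewrite -!colE !mxE.
Qed.

Lemma form_isometry g x y : isometry g -> form (g *m x) (g *m y) = form x y.
Proof.
by case=> _ gJ; rewrite /form trmx_mul -{2}gJ !mulmxA.
Qed.

Lemma isometry1 : isometry 1.
Proof. by split; rewrite ?unitr1 // trmx1 mul1mx mulmx1. Qed.

Lemma isometryM g h : isometry g -> isometry h -> isometry (g * h).
Proof.
move=> [gu gJ] [hu hJ]; split; first by rewrite unitrMl.
by rewrite trmx_mul -{2}hJ -{2}gJ !mulmxA.
Qed.

Lemma isometryV g : isometry g -> isometry g^-1.
Proof.
move=> [gu gJ]; split; first by rewrite unitrV.
have gV : g *m g^-1 = 1%:M by apply: mulrV.
rewrite -{1}gJ !mulmxA -trmx_mul gV trmx1 mul1mx.
by rewrite -mulmxA gV mulmx1.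
Qed.

Lemma isometryP g : J \in unitmx -> (g^T *m J *m g = J) -> isometry g.
Proof.
move=> Ju gJ; split=> //.
have : (invmx J *m g^T *m J) *m g = 1%:M by rewrite -!mulmxA (mulmxA g^T) gJ mulVmx.
by move=> /mulmx1_unit[].
Qed.

Lemma actM g h x : (g * h) *m x = g *m (h *m x).
Proof. by rewrite mulmxA. Qed.

Lemma actK g x : g \is a GRing.unit -> g^-1 *m (g *m x) = x.
Proof. by move=> gu; rewrite mulmxA (_ : _ *m g = 1) ?mul1mx //; apply: mulVr. Qed.

Lemma transv0 v : transv v 0 = 1.
Proof. by rewrite /transv scale0r addr0. Qed.

Lemma etransvC a b s : etransv a b s = etransv b a s.
Proof. by rewrite /etransv addrC [in RHS]addrC [_ *m _ + _]addrC. Qed.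

Lemma etransvZ k a b s : etransv a (k *: b) s = etransv a b (k * s).
Proof.
apply/mx_ext => x; rewrite !etransvE formE scalerA.
by congr (_ + _ *: _ + _ *: _); ring.
Qed.

Hypothesis alt : forall x, form x x = 0.

Lemma formC x y : form x y = - form y x.
Proof.
have := alt (x + y); rewrite !formE !alt add0r addr0 => /eqP.
by rewrite addr_eq0 => /eqP.
Qed.

Lemma transvD v s t : transv v s * transv v t = transv v (s + t).
Proof.
apply/mx_ext => x; rewrite actM !transvE !formE alt.
by apply/colP => i; rewrite !mxE; ring.
Qed.

Lemma transv_unit v s : transv v s \is a GRing.unit.
Proof.
apply/unitrP; exists (transv v (- s)).
by rewrite !transvD addNr subrr transv0.
Qed.

Lemma transvV v s : (transv v s)^-1 = transv v (- s).
Proof.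
apply: (mulrI (transv_unit v s)).
by rewrite mulrV ?transv_unit // transvD subrr transv0.
Qed.

Lemma transvX v s (k : nat) : transv v s ^+ k = transv v (s *+ k).
Proof. by elim: k => [|k IH]; rewrite ?expr0 ?mulr0n ?transv0 // exprS mulrS IH transvD. Qed.

Lemma transv_conj g v s : isometry g -> g * transv v s = transv (g *m v) s * g.
Proof.
move=> gJ; apply/mx_ext => x; rewrite !actM !transvE form_isometry //.
by rewrite mulmxDr scalemxAr.
Qed.

Lemma transv_conjV g v s : isometry g -> g * transv v s * g^-1 = transv (g *m v) s.
Proof. by move=> gJ; rewrite transv_conj // mulrK //; case: gJ. Qed.

Lemma form_matP g : (forall x y, form (g *m x) (g *m y) = form x y) -> g^T *m J *m g = J.
Proof.
move=> gJ; apply/matrixP => i j.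
have := gJ (delta_mx i 0) (delta_mx j 0).
rewrite /form trmx_mul !mulmxA -(mulmxA _ g^T) -(mulmxA _ (g^T *m J)).
by rewrite trmx_delta -!rowE -!colE !mxE.
Qed.

Lemma transv_isometry v s : isometry (transv v s).
Proof.
split; first exact: transv_unit.
apply: form_matP => x y; rewrite !transvE !formE alt (formC x v); ring.
Qed.

Lemma transvDe a b s : form a b = 0 ->
  transv (a + b) s = transv a s * transv b s * etransv a b s.
Proof.
move=> ab; have ba : form b a = 0 by rewrite formC ab oppr0.
apply/mx_ext => x; rewrite !actM !transvE !etransvE !formE ?ab ?ba !alt.
by apply/colP => i; rewrite !mxE; ring.
Qed.

Lemma etransv_transv a b s : form a b = 0 ->
  etransv a b s = transv (a + b) s * transv a (- s) * transv b (- s).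
Proof.
move=> ab; have ba : form b a = 0 by rewrite formC ab oppr0.
apply/mx_ext => x; rewrite !actM !transvE !etransvE !formE ?ab ?ba !alt.
by apply/colP => i; rewrite !mxE; ring.
Qed.

Lemma etransv_isometry a b s : form a b = 0 -> isometry (etransv a b s).
Proof.
by move=> ab; rewrite etransv_transv //; do ?[apply: isometryM | apply: transv_isometry].
Qed.

(** The law of the Heisenberg group of [a]: directions orthogonal to [a] add up, and [form] is the
    cocycle, with values in the central transvections along [a]. *)
Lemma etransvD a b c s t : form a b = 0 -> form a c = 0 ->
  etransv a b s * etransv a c t =
    etransv a (s *: b + t *: c) 1 * transv a (s * t * form b c).
Proof.
move=> ab ac; have ba : form b a = 0 by rewrite formC ab oppr0.
have ca : form c a = 0 by rewrite formC ac oppr0.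
apply/mx_ext => x; rewrite !actM !transvE !etransvE !formE ?ab ?ac ?ba ?ca !alt.
by apply/colP => i; rewrite !mxE; ring.
Qed.

Lemma etransv_transvC a b s t : form a b = 0 ->
  etransv a b s * transv a t = transv a t * etransv a b s.
Proof.
move=> ab; have ba : form b a = 0 by rewrite formC ab oppr0.
apply/mx_ext => x; rewrite !actM !transvE !etransvE !formE ?ab ?ba !alt.
by apply/colP => i; rewrite !mxE; ring.
Qed.

Lemma etransv1 a b s : etransv a b s = etransv a (s *: b) 1.
Proof. by rewrite etransvZ mulr1. Qed.

Lemma etransv0 a s : etransv a 0 s = 1.
Proof. by rewrite /etransv mul0mx trmx0 mul0mx mulmx0 addr0 scaler0 addr0. Qed.

Lemma etransvV a b s : form a b = 0 -> (etransv a b s)^-1 = etransv a b (- s).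
Proof.
move=> ab; have [u _] := etransv_isometry s ab.
apply: (mulrI u); rewrite mulrV // etransvD // alt mulr0 transv0 mulr1.
by rewrite -scalerDl subrr scale0r etransv0.
Qed.

(** The cocycle of [etransvD] is alternating, so that a commutator doubles it. The factors 2 in the
    levels below come from here. *)
Lemma etransv_comm a y z s t : form a y = 0 -> form a z = 0 ->
  etransv a y s * etransv a z t * (etransv a z t * etransv a y s)^-1 =
    transv a (2 * s * t * form y z).
Proof.
move=> ay az; rewrite !etransvD // [t *: _ + _]addrC.
set w := s *: y + t *: z.
have aw : form a w = 0 by rewrite !formE ay az !mulr0 addr0.
have [u _] := etransv_isometry 1 aw.
rewrite invrM ?transv_unit // transvV // !mulrA -[X in X * _^-1]mulrA transvD //.
rewrite etransv_transvC // mulrK // (formC z y).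
by congr transv; ring.
Qed.

End Transvections.

(** * Finite covers by cosets and Dietzmann's lemma *)

Definition unit_subgroup (R : unitRingType) (H : R -> Prop) :=
  [/\ forall x, H x -> x \is a GRing.unit, H 1,
      forall x y, H x -> H y -> H (x * y) & forall x, H x -> H x^-1].

(** [X] is any set, for instance a set of generators or a product of subgroups. Only the values
    [t i] that are used must lie in [X]. *)
Definition finitely_covered (R : unitRingType) (H X : R -> Prop) :=
  exists (I : finType) (t : I -> R),
    forall x, X x -> exists i, X (t i) /\ H ((t i)^-1 * x).

Section FiniteCovers.

Variables (R : unitRingType) (N : R -> Prop).
Hypothesis N_group : unit_subgroup N.

(** One element of each color represents its coset. A color is a relation because it often records a
    choice of decomposition of [x]. *)
Lemma finitely_covered_color (I : finType) (X : R -> Prop) (c : R -> I -> Prop) :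
  (forall x, X x -> exists i, c x i) ->
  (forall x y i, X x -> X y -> c x i -> c y i -> N (x^-1 * y)) ->
  finitely_covered N X.
Proof.
move=> cX cN.
have /choice[t tP] i : exists t, (exists2 x, X x & c x i) -> X t /\ c t i.
  have [[x Xx cx]|noX] := pselect (exists2 x, X x & c x i); first by exists x.
  (* A color that does not occur gets an arbitrary value. *)
  by exists 0.
exists I, t => x Xx; have [i cxi] := cX x Xx; exists i.
by have [] := tP i (ex_intro2 _ _ x Xx cxi); split=> //; apply: cN cxi.
Qed.

Lemma finitely_coveredS (X Y : R -> Prop) : (forall x, X x -> x \is a GRing.unit) ->
  (forall x, Y x -> x \is a GRing.unit) ->
  (forall x, X x -> exists2 y, Y y & N (y^-1 * x)) ->
  finitely_covered N Y -> finitely_covered N X.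
Proof.
have [_ _ NM NV] := N_group.
move=> Xu Yu XY [I [t tP]].
pose c x i := Y (t i) /\ N ((t i)^-1 * x).
apply: (@finitely_covered_color I X c) => [x Xx|x y i Xx Xy [Yt xi] [_ yi]].
  have [y Yy yx] := XY x Xx; have [i [Yi tyi]] := tP y Yy; exists i; split=> //.
  by rewrite -[x](mulVKr (Yu _ Yy)) mulrA; apply: NM.
rewrite -[y](mulVKr (Yu _ Yt)) mulrA; apply: NM => //.
by rewrite -[t i]invrK -invrM ?unitrV; [exact: NV|exact: Yu|exact: Xu].
Qed.

Lemma finitely_covered_trans (G K H : R -> Prop) :
  (forall x, G x -> x \is a GRing.unit) ->
  (forall x y, G x -> G y -> G (x * y)) -> (forall x, K x -> G x) ->
  finitely_covered K G -> finitely_covered H K -> finitely_covered H G.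
Proof.
move=> Gu GM KG [I [t tP]] [I' [s sP]].
exists (I * I')%type, (fun ij => t ij.1 * s ij.2) => x Gx.
have [i [Gti Ktx]] := tP x Gx; have [j [Ksj Hst]] := sP _ Ktx.
exists (i, j) => /=; split; first by apply: GM => //; apply: KG.
by rewrite invrM ?Gu -?mulrA //; apply: KG.
Qed.

Variable G : R -> Prop.
Hypotheses (G_group : unit_subgroup G) (NG : forall x, N x -> G x).
Hypothesis N_normal : forall g x, G g -> N x -> N (g^-1 * x * g).

(** Normality carries the error of [x] past the representative [s] of [y]: [(t * s)^-1 * (x * y)]
    equals [(s^-1 * (t^-1 * x) * s) * (s^-1 * y)]. *)
Lemma finitely_coveredM (X Y : R -> Prop) :
  (forall x, X x -> G x) -> (forall y, Y y -> G y) ->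
  finitely_covered N X -> finitely_covered N Y ->
  finitely_covered N (fun z => exists2 x, X x & exists2 y, Y y & z = x * y).
Proof.
have [Gu _ _ _] := G_group; have [_ _ NM _] := N_group.
move=> XG YG [I [t tP]] [I' [s sP]].
exists (I * I')%type, (fun ij => t ij.1 * s ij.2) => _ [x Xx [y Yy ->]].
have [i [Xti Ntx]] := tP x Xx; have [j [Ysj Nsy]] := sP y Yy.
exists (i, j) => /=; split; first by exists (t i) => //; exists (s j).
have sG := YG _ Ysj; have tG := XG _ Xti.
rewrite invrM ?Gu // -[y](mulVKr (Gu _ sG)) !mulrA; rewrite -mulrA.
by apply: NM => //; rewrite -!mulrA (mulrA _ x) mulrA; apply: N_normal.
Qed.

Lemma finitely_coveredU (X Y : R -> Prop) :
  finitely_covered N X -> finitely_covered N Y ->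
  finitely_covered N (fun x => X x \/ Y x).
Proof.
move=> [I [t tP]] [I' [s sP]].
exists (I + I')%type, (fun k => match k with inl i => t i | inr j => s j end).
move=> x [/tP[i [Xi Ni]]|/sP[j [Yj Nj]]]; [exists (inl i)|exists (inr j)];
  split=> //; by [left|right].
Qed.

Lemma finitely_covered1 : finitely_covered N (fun x => x = 1).
Proof.
have [_ N1 _ _] := N_group.
by exists unit, (fun=> 1) => x ->; exists tt; rewrite mulr1 invr1.
Qed.

Section Dietzmann.

Variables (C : R -> Prop) (M : nat).
Hypotheses (M_gt0 : (0 < M)%N) (CG : forall x, C x -> G x).
Hypothesis C_conj : forall g x, G g -> C x -> C (g^-1 * x * g).
Hypothesis C_torsion : forall x, C x -> N (x ^+ M).

Definition word (w : seq R) := forall x, x \in w -> C x.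

Definition word_span (g : R) :=
  exists2 w, word w & N ((\prod_(x <- w) x)^-1 * g).

Lemma word_cons x w : word (x :: w) <-> C x /\ word w.
Proof.
split=> [Cw|[Cx Cw] y]; last by rewrite inE => /predU1P[->|/Cw].
by split=> [|y yw]; apply: Cw; rewrite inE ?eqxx ?yw ?orbT.
Qed.

Lemma word_prodG w : word w -> G (\prod_(x <- w) x).
Proof.
have [_ G1 GM _] := G_group.
elim: w => [|x w IH]; first by rewrite big_nil.
by rewrite word_cons big_cons => -[/CG Gx /IH]; apply: GM.
Qed.

(** Letters of the coset of [t] are pulled to the front. A letter passed on the way is replaced by a
    conjugate, which is still in [C], so that the length drops by exactly [k]; the errors are
    collected in [n]. *)
Lemma word_extract t k w : C t -> word w ->
    (k <= count (fun x => `[< N (t^-1 * x) >]) w)%N ->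
  exists w' n, [/\ word w', size w' = (size w - k)%N, N n &
    \prod_(x <- w) x = t ^+ k * n * \prod_(x <- w') x].
Proof.
have [Gu G1 GM GV] := G_group; have [Nu N1 NM NV] := N_group.
move=> Ct; have Gt := CG Ct; have Gtk j : G (t ^+ j).
  by elim: j => [|j IH]; rewrite ?expr0 ?exprS //; apply: GM.
elim: w k => [|x w IH] [|k] // Cw.
- by move=> _; exists [::], 1; rewrite subn0 !mul1r.
- by move=> _; exists (x :: w), 1; rewrite subn0 !mul1r.
have [Cx {}/IH IH] := (word_cons _ _).1 Cw; rewrite /= big_cons.
have [/asboolP Nx|_] := boolP `[< N (t^-1 * x) >].
  rewrite add1n ltnS => /IH[w' [n [Cw' sw' Nn ->]]].
  exists w', ((t ^+ k)^-1 * (t^-1 * x) * t ^+ k * n); split=> //.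
    by apply: NM => //; apply: N_normal.
  by rewrite exprS !mulrA mulrK ?Gu // mulrV ?Gu // mul1r.
rewrite add0n => /[dup] lek /IH[w' [n [Cw' sw' Nn ->]]].
have Gtn : G (t ^+ k.+1 * n) by apply: GM => //; apply: NG.
exists (((t ^+ k.+1 * n)^-1 * x * (t ^+ k.+1 * n)) :: w'), n; split=> //.
- by rewrite word_cons; split=> //; apply: C_conj.
- by rewrite /= sw' subnSK // (leq_trans lek) ?count_size.
by rewrite big_cons !mulrA mulrV ?Gu // mul1r.
Qed.

Lemma word_shorten (I : finType) (t : I -> R) :
    (forall x, C x -> exists i, C (t i) /\ N ((t i)^-1 * x)) ->
  forall w, word w -> exists w', [/\ word w', (size w' <= #|I| * M)%N &
    N ((\prod_(x <- w') x)^-1 * \prod_(x <- w) x)].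
Proof.
have [Gu _ _ GV] := G_group; have [_ N1 NM _] := N_group.
move=> tP w; have [k] := ubnP (size w); elim: k => // k IH in w * => /ltnSE sw Cw.
have [le_w|gt_w] := leqP (size w) (#|I| * M).
  by exists w; split=> //; rewrite mulVr ?Gu //; apply: word_prodG.
pose p i x := `[< C (t i) /\ N ((t i)^-1 * x) >].
have: (size w <= \sum_i count (p i) w)%N.
  elim: w Cw {IH sw gt_w} => // x w IH /word_cons[/tP[i Cxi] /IH ltw].
  rewrite /= big_split -add1n leq_add //= (bigD1 i) //= [X in (X + _)%N](_ : _ = 1)%N //.
  by rewrite /p asboolT.
(* Pigeonhole: with fewer than [M] letters in every class, the word would have at most [#|I| * M]
   letters. *)
move=> lew; have [i Mi]: exists i, (M <= count (p i) w)%N.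
  apply/existsP; apply: contraLR gt_w => /existsPn noM; rewrite -leqNgt.
  rewrite (leq_trans lew) // -sum_nat_const leq_sum // => i _.
  by rewrite ltnW // ltnNge noM.
have Cti: C (t i).
  have: has (p i) w by rewrite has_count (leq_trans M_gt0).
  by case/hasP=> x _ /asboolP[].
have Mi' : (M <= count (fun x => `[< N ((t i)^-1 * x) >]) w)%N.
  by rewrite (leq_trans Mi) // sub_count // => x /asboolP[_ ?]; apply/asboolP.
have [w1 [n [Cw1 sw1 Nn ->]]] := word_extract Cti Cw Mi'.
have [|w' [Cw' sw' Nw']] := IH w1 _ Cw1.
  by rewrite sw1; lia.
have Gw1 := word_prodG Cw1; exists w'; split=> //.
(* The prefix [t i ^+ M * n] lies in [N], and conjugation by the product of [w1] moves it to the
   end. *)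
have := NM _ _ Nw' (N_normal Gw1 (NM _ _ (C_torsion Cti) Nn)).
by rewrite !mulrA mulrK ?Gu.
Qed.

Lemma finitely_covered_short_words k : finitely_covered N C ->
  finitely_covered N
    (fun g => exists w, [/\ word w, (size w <= k)%N & g = \prod_(x <- w) x]).
Proof.
have [Gu G1 GM _] := G_group; have [_ N1 _ _] := N_group.
move=> Cfin; elim: k => [|k IH].
  apply: finitely_coveredS finitely_covered1 => [x [w [/word_prodG Gw _ ->]]|x ->|].
  - exact: Gu.
  - exact: unitr1.
  move=> _ [[|x w] [_ // _ ->]]; exists 1 => //.
  by rewrite big_nil invr1 mul1r.
have := finitely_coveredM _ _ (finitely_coveredU Cfin finitely_covered1) IH.
move=> /(_ _ _)/finitely_coveredS fin; apply: fin.
- by move=> _ [w [/word_prodG Gw _ ->]]; apply: Gu.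
- move=> _ [x [/CG Gx|->] [_ [w [/word_prodG Gw _ ->]] ->]]; apply: Gu => //.
    exact: GM.
  by rewrite mul1r.
- move=> _ [[|x w] [Cw sw ->]].
    exists 1; last by rewrite big_nil invr1 mul1r.
    exists 1; first by right.
    by exists 1; [exists [::]; split=> //; rewrite big_nil | rewrite mul1r].
  have Gw := word_prodG Cw; exists (\prod_(y <- x :: w) y); last by rewrite mulVr ?Gu.
  have [Cx Cw'] := (word_cons _ _).1 Cw.
  by exists x; [left | exists (\prod_(y <- w) y); [exists w; split | rewrite big_cons]].
- by move=> x [/CG|->].
- by move=> x [w [/word_prodG Gw _ ->]].
Qed.

Lemma word_spanG g : word_span g -> G g.
Proof.
have [Gu _ GM _] := G_group.
case=> w /word_prodG Gw /NG Gwg; rewrite -(mulVKr (Gu _ Gw) g).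
exact: GM.
Qed.

(* [M] letters lying in one coset of [N] can be gathered at the front of a word,
   where they disappear modulo [N]; so words of bounded length suffice. *)
Lemma finitely_covered_word_span : finitely_covered N C -> finitely_covered N word_span.
Proof.
have [Gu _ _ _] := G_group; have [_ _ NM _] := N_group.
move=> Cfin; have [I [t tP]] := Cfin.
apply: finitely_coveredS (finitely_covered_short_words (#|I| * M) Cfin).
- by move=> g /word_spanG /Gu.
- by move=> _ [w [/word_prodG/Gu Gw _ ->]].
move=> g [w Cw Nwg]; have [w' [Cw' sw' Nw']] := word_shorten tP Cw.
exists (\prod_(x <- w') x); first by exists w'.
by rewrite -(mulVKr (Gu _ (word_prodG Cw)) g) mulrA; apply: NM.
Qed.

Lemma word_spanM g h : word_span g -> word_span h -> word_span (g * h).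
Proof.
have [Gu _ _ _] := G_group; have [_ _ NM _] := N_group.
move=> [w Cw Nw] [w' Cw' Nw'].
exists (w ++ w') => [x|]; first by rewrite mem_cat => /orP[/Cw|/Cw'].
have Gw := word_prodG Cw; have Gw' := word_prodG Cw'.
have := NM _ _ (N_normal Gw' Nw) Nw'.
by rewrite big_cat /= invrM ?Gu // !mulrA mulrK ?Gu.
Qed.

Lemma word_spanN g : N g -> word_span g.
Proof. by exists [::] => //; rewrite big_nil invr1 mul1r. Qed.

Lemma word_span_letter g : C g -> word_span g.
Proof.
have [Gu _ _ _] := G_group; have [_ N1 _ _] := N_group.
move=> Cg; exists [:: g] => [x|]; first by rewrite inE => /eqP->.
by rewrite big_seq1 mulVr // (Gu _ (CG Cg)).
Qed.

End Dietzmann.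
End FiniteCovers.

(** * Finite index in the integral symplectic group *)

(** Reduction modulo [D]. The residues are stored in ['I_D.+1], since [inord] needs a successor. *)
Definition mxmod (D : nat) p q (A : 'M[int]_(p, q)) : 'M['I_D.+1]_(p, q) :=
  map_mx (fun x : int => inord `|(x %% D)%Z|%N) A.

Lemma mxmod_eq D p q (A B : 'M[int]_(p, q)) : (0 < D)%N ->
  mxmod D A = mxmod D B -> exists C, B = A + D%:Z *: C.
Proof.
move=> D_gt0 /matrixP AB; exists (map_mx (fun x => x %/ D)%Z (B - A)).
apply/matrixP => i j; rewrite !mxE mulrC divzK; first by rewrite addrC subrK.
have D_neq0 : D%:Z != 0 by lia.
have mod_lt x : (`|(x %% D)%Z| < D.+1)%N.
  by have := modz_ge0 x D_neq0; have := ltz_pmod x (d := D%:Z); lia.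
have := AB i j; rewrite !mxE => /(congr1 val) /=.
rewrite !inordK // => ABij; rewrite -eqz_mod_dvd; apply/eqP.
by have := modz_ge0 (A i j) D_neq0; have := modz_ge0 (B i j) D_neq0; lia.
Qed.

(** A stable range property. Take for [t] the largest divisor of [q] prime to [p]. A common prime
    divisor of [q] and [p + t * c] that divides [p] is prime to [t], hence divides [c], against the
    Bezout relation; one that does not divide [p] divides [t], hence [p] after all. *)
Lemma coprime_shift (p q c a b d : int) : q != 0 -> p * a + q * b + c * d = 1 ->
  exists t i j, i * (p + t * c) + j * q = 1.
Proof.
(* The set of primes attached to 0 is empty, so that the choice of [t] below would fail for
   [p = 0]. *)
move=> q0 pqc; have [p0|p0] := eqVneq p 0.
  by exists 1, d, b; rewrite -[RHS]pqc p0; ring.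
pose pi := (\pi(absz p)^')%N; pose t := ((absz q)`_pi)%N.
suff /coprimezP[[i j] ij] : coprimez (p + t%:Z * c) q by exists t%:Z, i, j.
rewrite /coprimez /gcdz eqz_nat; apply: contraT => gcd1.
have q_gt0 : (0 < `|q|)%N by rewrite absz_gt0.
have : (1 < gcdn `|(p + t%:Z * c)%R| `|q|)%N.
  by rewrite ltn_neqAle eq_sym gcd1 gcdn_gt0 q_gt0 orbT.
case/pdivP=> r r_pr; rewrite dvdn_gcd => /andP[r_ptc r_q].
have [r_p|r_p] := boolP (r %| `|p|)%N.
  have r_tc : (r %| t * `|c|)%N.
    rewrite -[t]/(`|t%:Z|)%N -abszM.
    by move: r_ptc r_p; rewrite -!(dvdzE r%:Z) => r1 r2; rewrite rpredDl in r1.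
  have r_c : (r %| `|c|)%N.
    move: r_tc; rewrite Euclid_dvdM // => /orP[r_t|//].
    have /(pnatP _ (part_gt0 _ _))/(_ r r_pr r_t) := part_pnat pi (absz q).
    by rewrite !inE mem_primes r_pr r_p absz_gt0 p0.
  have : (r%:Z %| p * a + q * b + c * d)%Z by rewrite !rpredD // dvdz_mulr // dvdzE.
  by rewrite pqc dvdzE /= dvdn1 => /eqP r1; rewrite r1 in r_pr.
have r_t : (r %| t)%N.
  rewrite -(part_pnat_id (pi := pi) (n := r)) ?pnatE //.
    exact: partn_dvd.
  by rewrite !inE mem_primes r_pr (negPf r_p) andbF.
case/negP: r_p; move: r_ptc; rewrite -!(dvdzE r%:Z) rpredDr //.
by rewrite dvdz_mulr // dvdzE.
Qed.

Section FiniteIndex.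

Variables (n : nat) (J : 'M[int]_n.+1).
Implicit Types (x y v w a b c : 'cV[int]_n.+1) (s t k : int) (g h : 'M[int]_n.+1).
Local Notation form := (form J).
Local Notation transv := (transv J).
Local Notation etransv := (etransv J).
Local Notation isometry := (isometry J).
Hypothesis alt : forall x, form x x = 0.
Let formC := formC alt.

Lemma isometry_group : unit_subgroup isometry.
Proof.
split=> [g []|||] //; [exact: isometry1 | exact: isometryM | exact: isometryV].
Qed.

Lemma isometry_unit g : isometry g -> g \is a GRing.unit. Proof. by case. Qed.

(** * Powers of transvections and Heisenberg groups *)

Section Level.

Variable M : nat.
Hypothesis M_gt0 : (0 < M)%N.

(** The coefficients [p.2] may be negative, so that plain products of generators already form a
    group. *)
Definition transv_group g :=
  exists w : seq ('cV[int]_n.+1 * int), g = \prod_(p <- w) transv p.1 (M%:Z * p.2).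

Lemma transv_group_isometry g : transv_group g -> isometry g.
Proof.
case=> w ->; elim: w => [|p w IH]; first by rewrite big_nil; apply: isometry1.
by rewrite big_cons; apply: isometryM => //; apply: transv_isometry.
Qed.

Lemma transv_in_group v k : transv_group (transv v (M%:Z * k)).
Proof. by exists [:: (v, k)]; rewrite big_seq1. Qed.

Lemma transv_group_group : unit_subgroup transv_group.
Proof.
split=> [g /transv_group_isometry[]|| g h [w ->] [w' ->] | _ [w ->]] //.
- by exists [::]; rewrite big_nil.
- by exists (w ++ w'); rewrite big_cat.
exists (rev [seq (p.1, - p.2) | p <- w]).
elim: w => [|p w IH]; first by rewrite !big_nil invr1.
rewrite big_cons rev_cons -cats1 big_cat big_seq1 /= -IH mulrN -transvV //.
rewrite invrM ?transv_unit //; apply: isometry_unit.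
by apply: transv_group_isometry; exists w.
Qed.

Lemma transv_group_normal g h : isometry g -> transv_group h ->
  transv_group (g^-1 * h * g).
Proof.
move=> /(isometryV)gV [w ->]; have [gVu _] := gV.
exists [seq (g^-1 *m p.1, p.2) | p <- w].
elim: w => [|p w IH]; first by rewrite !big_nil mulr1 -{2}[g]invrK mulrV.
by rewrite !big_cons /= -IH !mulrA transv_conj //.
Qed.

Lemma etransv_in_group a b k : form a b = 0 -> transv_group (etransv a b (M%:Z * k)).
Proof.
have [_ _ NM _] := transv_group_group.
move=> ab; rewrite etransv_transv // -mulrN.
by apply: (NM); [apply: (NM)|]; apply: transv_in_group.
Qed.

(** For a hyperbolic pair [a], [b], these are the elements of the unipotent radical of the
    stabilizer of the line of [a], in normal form, with directions in [L]. *)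
Definition heis (L : 'cV[int]_n.+1 -> Prop) a b g := exists w t,
  [/\ L w, form a w = 0, form b w = 0 & g = etransv a w 1 * transv a t].

Lemma heis_isometry L a b g : heis L a b g -> isometry g.
Proof.
case=> w [t [_ aw _ ->]].
by apply: isometryM; [apply: etransv_isometry | apply: transv_isometry].
Qed.

(** By the Heisenberg law, a class is determined by [w] and [t] modulo [M]. The scalar [t] is made a
    matrix of size 1 so that [mxmod] applies to it. *)
Lemma finitely_covered_heis L a b : finitely_covered transv_group (heis L a b).
Proof.
have [_ _ NM _] := transv_group_group.
have M_neq0 : M%:Z != 0 by lia.
pose I := ('M['I_M.+1]_(n.+1, 1) * 'M['I_M.+1]_1)%type.
pose c g (i : I) := exists w t,
  [/\ form a w = 0, g = etransv a w 1 * transv a t, mxmod M w = i.1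
    & mxmod M (t%:M : 'M_1) = i.2].
apply: (@finitely_covered_color _ _ I _ c).
  by move=> g [w [t [_ aw _ ->]]]; exists (mxmod M w, mxmod M t%:M), w, t.
move=> _ _ i _ _ [w [t [aw -> wi ti]]] [w' [t' [aw' -> wi' ti']]].
have /(mxmod_eq M_gt0)[z zE] : mxmod M w = mxmod M w' by rewrite wi.
have /(mxmod_eq M_gt0)[k /matrixP/(_ 0 0)] :
  mxmod M (t%:M : 'M_1) = mxmod M t'%:M by rewrite ti.
rewrite !mxE eqxx !mulr1n => t'E.
have az : form a z = 0.
  have : form a w' = 0 := aw'.
  by rewrite zE !formE aw add0r => /eqP; rewrite mulf_eq0 (negPf M_neq0) => /eqP.
suff -> : (etransv a w 1 * transv a t)^-1 * (etransv a w' 1 * transv a t') =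
    etransv a z (M%:Z * 1) * transv a (M%:Z * (k 0 0 - form w z)).
  by apply: NM; [apply: etransv_in_group | apply: transv_in_group].
have [u _] := etransv_isometry alt 1 aw.
rewrite invrM ?transv_unit // transvV // etransvV //.
rewrite -[transv a (- t) * _]etransv_transvC // -!mulrA (mulrA (transv _ _)).
rewrite -etransv_transvC // !mulrA etransvD // -!mulrA !transvD //.
rewrite t'E zE !formE alt mulr1 (etransv1 _ _ _ M%:Z).
congr (etransv _ _ _ * transv _ _); last by ring.
by rewrite scaleN1r scale1r addrA addNr add0r.
Qed.

End Level.

(** * Transitivity on unimodular vectors *)

Definition sublattice (L : 'cV[int]_n.+1 -> Prop) :=
  (forall x y, L x -> L y -> L (x + y)) /\ (forall k x, L x -> L (k *: x)).

Lemma heisV L a b g : sublattice L -> heis L a b g -> heis L a b g^-1.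
Proof.
move=> [_ LZ] [w [t [Lw aw bw ->]]]; exists ((-1) *: w), (- t); split.
- exact: LZ.
- by rewrite !formE aw mulr0.
- by rewrite !formE bw mulr0.
have [u _] := etransv_isometry alt 1 aw.
rewrite invrM ?transv_unit // transvV // etransvV // etransvZ mulr1.
by rewrite etransv_transvC.
Qed.

Definition hyperbolic_pairs e f e' f' :=
  [/\ form e f = 1, form e' f' = 1, form e e' = 0, form e f' = 0 &
      form f e' = 0 /\ form f f' = 0].

(** The first move makes the coordinates on the second plane coprime, the second makes the
    coordinate on [e] equal to 1, and the third clears all others. *)
Lemma unimodular_reduction L e f e' f' v u :
    sublattice L -> (L e /\ L f) -> (L e' /\ L f') -> (L v /\ L u) ->
    hyperbolic_pairs e f e' f' -> form v u = 1 ->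
  exists g1 g2 g3, [/\ heis L e' f' g1 \/ heis L f' e' g1, heis L e f g2,
    heis L f e g3 & g3 *m (g2 *m (g1 *m v)) = e].
Proof.
move=> [LD LZ] [Le Lf] [Le' Lf'] [Lv Lu] [ef ef' ee' e_f' [fe' ff']] vu.
have LN x : L x -> L (- x) by rewrite -scaleN1r; apply: LZ.
have fe : form f e = -1 by rewrite formC ef.
have f'e' : form f' e' = -1 by rewrite formC ef'.
have e'e : form e' e = 0 by rewrite formC ee' oppr0.
have e'f : form e' f = 0 by rewrite formC fe' oppr0.
have f'e : form f' e = 0 by rewrite formC e_f' oppr0.
have f'f : form f' f = 0 by rewrite formC ff' oppr0.
pose formV := (ef, ef', ee', e_f', fe', ff', fe, f'e', e'e, e'f, f'e, f'f, alt).
(* The coordinates of [v] on the plane [e', f'] become coprime, so that some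
   vector [w] of this plane satisfies [form w v = 1]. *)
have [g1 [i [j [g1_heis ij]]]] : exists g1 i j,
    (heis L e' f' g1 \/ heis L f' e' g1) /\
    i * form (g1 *m v) f' + j * form e' (g1 *m v) = 1.
  (* These are the coordinates of [v] on the plane of [e'] and [f'], and [z] is the component of [u]
     orthogonal to it. Then [vu] becomes a Bezout relation between [p], [q] and [form z v]. *)
  pose p := form v f'; pose q := form e' v.
  pose z := u + (- form u f') *: e' + (- form e' u) *: f'.
  have Lz : L z by do ?apply: (LD) => //; apply: LZ.
  have e'z : form e' z = 0 by rewrite !formE !formV; ring.
  have f'z : form f' z = 0 by rewrite !formE !formV (formC f' u); ring.
  have ze' : form z e' = 0 by rewrite formC e'z oppr0.
  have zf' : form z f' = 0 by rewrite formC f'z oppr0.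
  have pqz : p * form e' u + q * - form u f' + form z v * -1 = 1.
    by rewrite -[RHS]vu !formE /p /q (formC u v) (formC f' v); ring.
  clearbody z.
  (* If [q = 0], a move along [f'] replaces [q] by [form z v]. Otherwise a move along [e'] replaces
     [p] by [p + t * form z v]. *)
  have [q0|q0] := eqVneq q 0.
    exists (etransv f' z 1), (form e' u), (-1); split.
      by right; exists z, 0; rewrite transv0 mulr1.
    rewrite etransvE !formE !formV zf' e'z -/q q0 -/p -[RHS]pqz q0; ring.
  have [t [i [j ij]]] := coprime_shift q0 pqz.
  exists (etransv e' (t *: z) 1), i, j; split.
    by left; exists (t *: z), 0; rewrite transv0 mulr1 !formE e'z f'z mulr0;
       split=> //; apply: LZ.
  rewrite etransvE !formE !formV zf' e'z -/q -/p -[RHS]ij; ring.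
set v1 := g1 *m v in ij *.
have Lv1 : L v1.
  have Lact a b g : L a -> heis L a b g -> L (g *m v).
    move=> La [w [t [Lw _ _ ->]]].
    by rewrite actM etransvE transvE; do ?[apply: (LD) | apply: (LZ)].
  by case: g1_heis; apply: Lact.
pose w := i *: (- f') + j *: e'.
have wv1 : form w v1 = 1 by rewrite !formE (formC f' v1) -[RHS]ij; ring.
have Lw : L w by apply: LD; apply: LZ => //; apply: LN.
have [ew fw wf] : [/\ form e w = 0, form f w = 0 & form w f = 0].
  by rewrite !formE !formV; split; ring.
(* As [form w v1 = 1], the move by [s *: w] adds [s] to the coordinate on [e]. *)
clearbody w; pose s := 1 - form v1 f.
have [v2 v2def] : exists x, x = etransv e (s *: w) 1 *m v1.
  by exists (etransv e (s *: w) 1 *m v1).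
have v2E : v2 = v1 + s *: e + (form e v1 * s) *: w.
  by rewrite v2def etransvE !formE wv1 scalerA !mul1r mulr1.
have v2f : form v2 f = 1 by rewrite v2E !formE wf !formV /s; ring.
have Lv2 : L v2 by rewrite v2E; apply: (LD); [apply: (LD) |] => //; apply: LZ.
have fv2 : form f v2 = - 1 by rewrite formC v2f.
(* The component of [v2] orthogonal to the plane of [e] and [f], as its coordinate on [e] is now
   1. *)
pose y := v2 + (- 1) *: e + (- form e v2) *: f.
exists g1, (etransv e (s *: w) 1), (etransv f y 1 * transv f (form e v2)).
split=> //.
- exists (s *: w), 0; rewrite transv0 mulr1 !formE ew fw mulr0; split=> //.
  exact: LZ.
- exists y, (form e v2); rewrite /y !formE !formV fv2; split=> //; try ring.
  by apply: (LD); [apply: (LD) |] => //; apply: LZ.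
rewrite -/v1 -v2def actM transvE etransvE /y !formE !formV fv2 v2f.
by apply/colP => k; rewrite !mxE; ring.
Qed.

Definition unimodular v := exists u, form v u = 1.

Lemma unimodular_sign v u : form v u = 1 \/ form v u = -1 -> unimodular v.
Proof. by case=> vu; [exists u | exists (- u); rewrite formE vu opprK]. Qed.

Definition unimodular_transv g := exists2 v, unimodular v & g = transv v 1.

(** The last clause makes these vectors span: what remains of [x] after subtracting its components
    on the planes is orthogonal to all of them. *)
Definition symplectic_basis r (e f : nat -> 'cV[int]_n.+1) :=
  [/\ forall i, (i < r)%N -> form (e i) (f i) = 1,
      forall i j, (i < r)%N -> (j < r)%N -> i != j ->
        [/\ form (e i) (e j) = 0, form (e i) (f j) = 0,
            form (f i) (e j) = 0 & form (f i) (f j) = 0]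
    & forall x, (forall i, (i < r)%N -> form (e i) x = 0 /\ form (f i) x = 0) -> x = 0].

(** * Finiteness of the integral symplectic group modulo powers of transvections *)

Section Basis.

Variables (r : nat) (e f : nat -> 'cV[int]_n.+1).
Hypotheses (ef_basis : symplectic_basis r e f) (r_ge2 : (1 < r)%N).
Variable M : nat.
Hypothesis M_gt0 : (0 < M)%N.
Local Notation N := (transv_group M).

Lemma basis_hyperbolic i j : (i < r)%N -> (j < r)%N -> i != j ->
  hyperbolic_pairs (e i) (f i) (e j) (f j).
Proof.
have [ef1 orth _] := ef_basis => ir jr ij.
by have [? ? ? ?] := orth i j ir jr ij; split; rewrite ?ef1.
Qed.

(** Each unimodular vector is [g *m e 0] with [g] in a product of three Heisenberg sets, and modulo
    [N] its transvection depends only on the coset of [g]. *)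
Lemma finitely_covered_unimodular : finitely_covered N unimodular_transv.
Proof.
have N_group := transv_group_group M; have G_group := isometry_group.
have [_ _ NM NV] := N_group; have [_ _ GM GV] := G_group.
have NG := transv_group_isometry (M := M).
have NJ := transv_group_normal (M := M).
have hyp := basis_hyperbolic (ltnW r_ge2) r_ge2 isT.
pose L (x : 'cV[int]_n.+1) := True.
have heisG a b g (hg : heis L a b g) := heis_isometry hg.
have cov a b := finitely_covered_heis M_gt0 L a b.
pose X1 g := heis L (e 1) (f 1) g \/ heis L (f 1) (e 1) g.
pose X2 g := exists2 g1, X1 g1 & exists2 g2, heis L (e 0) (f 0) g2 & g = g1 * g2.
pose X3 g := exists2 g1, X2 g1 & exists2 g2, heis L (f 0) (e 0) g2 & g = g1 * g2.
have X1G g : X1 g -> isometry g by case; apply: heisG.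
have X2G g : X2 g -> isometry g.
  by case=> ? /X1G ? [? /heisG ? ->]; apply: GM.
have X3G g : X3 g -> isometry g.
  by case=> ? /X2G ? [? /heisG ? ->]; apply: GM.
have covX1 : finitely_covered N X1 by apply: finitely_coveredU.
have covX2 : finitely_covered N X2.
  by apply: (finitely_coveredM N_group G_group NJ X1G _ covX1 (cov _ _)) => g /heisG.
have [I [t tP]] : finitely_covered N X3.
  by apply: (finitely_coveredM N_group G_group NJ X2G _ covX2 (cov _ _)) => g /heisG.
have subL : sublattice L by [].
have orbit v : unimodular v -> exists2 g, X3 g & v = g *m e 0.
  case=> u vu.
  have [//|//|//|g1 [g2 [g3 [g1h g2h g3h gv]]]] :=
    @unimodular_reduction L _ _ _ _ v u subL _ _ _ hyp vu.
  have [g1u g2u g3u] : [/\ g1 \is a GRing.unit, g2 \is a GRing.unit & g3 \is a GRing.unit].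
    by split; apply: isometry_unit; [apply: X1G | apply: heisG g2h | apply: heisG g3h].
  exists (g1^-1 * g2^-1 * g3^-1); last by rewrite -gv !actM !actK.
  exists (g1^-1 * g2^-1); last by exists g3^-1 => //; apply: heisV.
  exists g1^-1; last by exists g2^-1 => //; apply: heisV.
  by case: g1h => ?; [left|right]; apply: heisV.
pose c h i := exists2 g, X3 g &
  [/\ h = g * transv (e 0) 1 * g^-1, X3 (t i) & N ((t i)^-1 * g)].
apply: (@finitely_covered_color _ _ I _ c) => [_ [v /orbit[g Xg ->] ->]|].
  have [i [Xt Nt]] := tP g Xg; exists i, g => //; split=> //.
  by rewrite transv_conjV //; apply: X3G.
move=> _ _ i _ _ [g Xg [-> Xt Ng]] [g' Xg' [-> _ Ng']].
have [Gg Gg' Gt] := And3 (X3G _ Xg) (X3G _ Xg') (X3G _ Xt).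
have gu := isometry_unit Gg; have g'u := isometry_unit Gg'; have tu := isometry_unit Gt.
have GT := transv_isometry alt (e 0) 1; set T := transv (e 0) 1 in GT *.
have Tu := isometry_unit GT.
pose x := g^-1 * g'.
have Nx : N x.
  rewrite /x -(mulVKr tu g') mulrA; apply: NM => //.
  by rewrite -[t i]invrK -invrM ?unitrV //; apply: NV.
have xu : x \is a GRing.unit by apply: isometry_unit; apply: NG.
have g'E : g' = g * x by rewrite /x mulVKr.
clearbody x.
(* The quotient is a conjugate of a commutator of [T] with [x], and [x] is in the normal subgroup
   [N]. *)
have -> : (g * T * g^-1)^-1 * (g' * T * g'^-1) =
    (g^-1)^-1 * (T^-1 * x * T * x^-1) * g^-1.
  rewrite g'E !invrM ?unitrMl ?unitrV //; first by rewrite !mulrA mulrVK.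
apply: (NJ g^-1); first exact: GV.
by apply: NM; [apply: NJ | apply: NV].
Qed.

Local Notation span := (word_span N unimodular_transv).

Let N_group := transv_group_group M.
Let G_group := isometry_group.
Let NG := @transv_group_isometry M.
Let NJ := @transv_group_normal M.

Let CG g : unimodular_transv g -> isometry g.
Proof. by case=> v _ ->; apply: transv_isometry. Qed.

Let spanM g h : span g -> span h -> span (g * h).
Proof. exact: (word_spanM N_group G_group NJ CG). Qed.

(** Words contain no inverses, so [s] is replaced by its remainder modulo [M]; the rest is absorbed
    in [N]. *)
Lemma span_unimodular v s : unimodular v -> span (transv v s).
Proof.
move=> vu; have M_neq0 : M%:Z != 0 by lia.
rewrite (divz_eq s M) mulrC -transvD // -[(s %% M)%Z]gez0_abs ?modz_ge0 //.
apply: spanM; first by apply: word_spanN => //; apply: transv_in_group.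
elim: `|_|%N => [|k IH].
  by rewrite transv0; apply: word_spanN => //; have [_ ? _ _] := N_group.
rewrite intS -transvD //; apply: spanM => //.
by apply: (word_span_letter N_group G_group CG); exists v.
Qed.

(** Since [w] itself may fail to be unimodular, it is split as [y + (w - y)]. Each part pairs to 1
    with a vector of the plane [j], and [etransv_transv] then uses unimodular directions only. *)
Lemma span_heis L i j a b g : (i < r)%N -> (j < r)%N -> i != j ->
    (a = e i /\ b = f i \/ a = f i /\ b = e i) ->
  heis L a b g -> span g.
Proof.
move=> ir jr ij ab [w [t [_ aw bw ->]]].
have [ef1 orth _] := ef_basis.
have [iijj ijij jiji jjii] := orth i j ir jr ij.
have ef_j := ef1 j jr.
have [a_b ae af be bf] : [/\ form a b = 1 \/ form a b = -1, form a (e j) = 0,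
    form a (f j) = 0, form b (e j) = 0 & form b (f j) = 0].
  case: ab => -[-> ->]; split=> //; first by left; apply: ef1.
  by right; rewrite formC ef1.
have ba : form b a = - form a b by rewrite formC.
have span_etransv v c : form a v = 0 -> form b v = 0 -> form v c = 1 -> span (etransv a v 1).
  move=> av bv vc; rewrite etransv_transv //.
  do 2?apply: (spanM); apply: span_unimodular.
  - apply: (@unimodular_sign _ b); rewrite formE (formC v b) bv oppr0 addr0.
    exact: a_b.
  - exact: (@unimodular_sign _ b).
  by exists c.
pose y := (form w (f j) - 1) *: e j + f j.
have ay : form a y = 0 by rewrite !formE ae af mulr0 addr0.
have bby : form b y = 0 by rewrite !formE be bf mulr0 addr0.
have yE : form y (- e j) = 1.
  by rewrite !formE alt (formC (f j)) ef_j; ring.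
have wyE : form (w - y) (f j) = 1 by rewrite !formE alt ef_j; ring.
clearbody y.
have awy : form a (w - y) = 0 by rewrite !formE aw ay oppr0 addr0.
have bwy : form b (w - y) = 0 by rewrite !formE bw bby oppr0 addr0.
have a_u : unimodular a by apply: (@unimodular_sign _ b).
have -> : etransv a w 1 = etransv a y 1 * etransv a (w - y) 1 * transv a (- form y (w - y)).
  rewrite etransvD // -mulrA transvD // !scale1r addrC subrK !mul1r.
  by rewrite subrr transv0 mulr1.
do 2![apply: spanM; last exact: span_unimodular]; apply: spanM.
- exact: span_etransv _ _ ay bby yE.
- exact: span_etransv _ _ awy bwy wyE.
Qed.

(** One more plane is fixed at each step: elements of the span acting on the orthogonal [L] of the
    first [k] planes bring [g *m e k] back to [e k], then the image of [f k] back to [f k]. *)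
Lemma span_isometry (k : nat) g : (k <= r)%N -> isometry g ->
  (forall i, (i < k)%N -> g *m e i = e i /\ g *m f i = f i) -> span g.
Proof.
have [ef1 orth nondeg] := ef_basis.
have [_ _ GM GV] := G_group.
have [m] := ubnP (r - k)%N; elim: m => // m IH in k g *.
move=> /ltnSE rk kr gG gfix.
move: kr; rewrite leq_eqVlt => /predU1P[kr|kr].
  suff -> : g = 1 by apply: word_spanN => //; case: N_group.
  apply: mx_ext => x; rewrite mul1mx; apply/eqP; rewrite -subr_eq0; apply/eqP.
  apply: nondeg => i; rewrite -kr => /gfix[ei fi].
  by rewrite !formE -{1}ei -{1}fi !form_isometry // !subrr.
pose L x := forall i, (i < k)%N -> form (e i) x = 0 /\ form (f i) x = 0.
have LD x y : L x -> L y -> L (x + y).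
  by move=> Lx Ly i ik; have [ex fx] := Lx i ik; have [ey fy] := Ly i ik;
     rewrite !formE ex fx ey fy.
have LZ s x : L x -> L (s *: x).
  by move=> Lx i ik; have [ex fx] := Lx i ik; rewrite !formE ex fx mulr0.
have Lact h x : isometry h -> (forall i, (i < k)%N -> h *m e i = e i /\ h *m f i = f i) ->
    L x -> L (h *m x).
  move=> hG hfix Lx i ik; have [ei fi] := hfix i ik.
  by rewrite -{1}ei -{1}fi !form_isometry //; apply: Lx.
have Le i : (k <= i < r)%N -> L (e i) /\ L (f i).
  move=> /andP[ki ir]; have jlt j : (j < k)%N -> (j < r)%N /\ j != i by lia.
  by split=> j /jlt[jr ji]; have [? ? ? ?] := orth j i jr ir ji.
have [Lek Lfk] : L (e k) /\ L (f k) by apply: Le; lia.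
have ek_fk := ef1 k kr.
(* Both [h] and its inverse are recorded because closure of the span under inverses is not
   established at this point. *)
pose good h := [/\ isometry h, span h, span h^-1 &
  forall i, (i < k)%N -> h *m e i = e i /\ h *m f i = f i].
have goodM h h' : good h -> good h' -> good (h * h').
  move=> [hG hs hVs hf] [h'G h's h'Vs h'f]; split; [exact: GM | exact: spanM | |].
    by rewrite invrM ?isometry_unit //; apply: spanM.
  move=> i ik; have [he hf_] := hf i ik; have [h'e h'f_] := h'f i ik.
  by rewrite !actM h'e h'f_.
have good_transv v s : L v -> unimodular v -> good (transv v s).
  move=> Lv vu; split; first exact: transv_isometry.
  - exact: span_unimodular.
  - by rewrite transvV //; apply: span_unimodular.
  move=> i ik; have [ev fv] := Lv i ik.
  by rewrite !transvE formC ev formC fv !oppr0 mulr0 !scale0r !addr0.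
have good_heis i j a b h : (k <= i < r)%N -> (k <= j < r)%N -> i != j ->
    (a = e i /\ b = f i \/ a = f i /\ b = e i) -> heis L a b h -> good h.
  move=> ir jr ij ab hh; have [La Lb] : L a /\ L b.
    by have [] := Le i ir; case: ab => -[-> ->].
  have spanh u : heis L a b u -> span u.
    by apply: (span_heis _ _ ij ab); [case/andP: ir | case/andP: jr].
  split; [exact: heis_isometry hh | exact: spanh | exact/spanh/heisV |].
  move=> l lk; have [w [t [Lw _ _ ->]]] := hh.
  have [ea fa] := La l lk; have [ew fw] := Lw l lk.
  rewrite !actM !transvE !(formC a) ea fa !oppr0 mulr0 !scale0r !addr0.
  by rewrite !etransvE !(formC a) !(formC w) ea fa ew fw !oppr0 mulr0 !scale0r !addr0.
(* [w - v] is the direction of a transvection carrying [v] to [w]. *)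
have link v w : L v -> L w -> form v w = 1 \/ form v w = -1 ->
    exists2 h, good h & h *m v = w.
  move=> Lv Lw vw; have wv : form w v = - form v w by rewrite formC.
  exists (transv (w - v) (- form v w)).
    apply: good_transv; first by rewrite -scaleN1r; apply: LD => //; apply: LZ.
    by apply: (@unimodular_sign _ w); rewrite !formE alt sub0r; lia.
  rewrite transvE !formE alt wv oppr0 addr0.
  have -> : - form v w * - form v w = 1 by case: vw => ->.
  by rewrite scale1r addrC subrK.
have to_ek v u : L v -> L u -> form v u = 1 -> exists2 h, good h & h *m v = e k.
  have [k1r|k1r] := ltnP k.+1 r.
    move=> Lv Lu vu; have kk1 : k != k.+1 by lia.
    have kkr : (k <= k < r)%N by lia.
    have kk1r : (k <= k.+1 < r)%N by lia.
    have [g1 [g2 [g3 [g1h g2h g3h gv]]]] := unimodular_reduction (conj LD LZ)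
      (Le _ kkr) (Le _ kk1r) (conj Lv Lu) (basis_hyperbolic kr k1r kk1) vu.
    exists (g3 * (g2 * g1)); last by rewrite !actM.
    apply: (goodM); [|apply: (goodM)].
    - by apply: (good_heis k k.+1) g3h => //; right.
    - by apply: (good_heis k k.+1) g2h => //; left.
    by rewrite eq_sym in kk1; case: g1h => /(good_heis k.+1 k); apply=> //; [left|right].
  (* With a single plane left, Euclid's algorithm is run on the coordinate [form (e k) v]. *)
  have rE : r = k.+1 by apply/eqP; rewrite eqn_leq k1r.
  have [l] := ubnP `|form (e k) v|%N; elim: l => // l IHl in v u *.
  move=> /ltnSE lev Lv Lu vu.
  have [q0|q0] := eqVneq (form (e k) v) 0.
    have vE : v = form v (f k) *: e k.
      apply/eqP; rewrite -subr_eq0; apply/eqP; apply: nondeg => i.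
      rewrite rE ltnS leq_eqVlt => /predU1P[->|ik].
        rewrite !formE q0 alt (formC (f k) v) (formC (f k) (e k)) ek_fk; split; ring.
      have [ev fv] := Lv i ik; have [eek fek] := Lek i ik.
      by rewrite !formE ev fv eek fek mulr0 subrr.
    have vfk_u : form v (f k) * form (e k) u = 1 by rewrite -[RHS]vu [in RHS]vE formE.
    have vfk : form v (f k) = 1 \/ form v (f k) = -1.
      by have /eqP := congr1 absz vfk_u; rewrite abszM muln_eq1 => /andP[]; lia.
    have fk_ek : form (f k) (e k) = -1 by rewrite formC ek_fk.
    (* Here [v] is [e k] up to sign, hence orthogonal to [e k], and the path goes through [f k]. *)
    have [h1 h1g h1v] := link _ _ Lv Lfk vfk.
    have [h2 h2g h2v] := link _ _ Lfk Lek (or_intror fk_ek).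
    by exists (h2 * h1); [apply: goodM | rewrite actM h1v h2v].
  (* Division step: [w] still pairs to 1 with [v], and its coordinate is the remainder. The next
     pair is [w] and [- v]. *)
  pose w := u + (- (form (e k) u %/ form (e k) v)%Z) *: v.
  have Lw : L w by apply: LD => //; apply: LZ.
  have vw : form v w = 1 by rewrite !formE alt vu mulr0 addr0.
  have wv : form w (- v) = 1 by rewrite formE formC vw opprK.
  have ew : form (e k) w = (form (e k) u %% form (e k) v)%Z.
    by rewrite !formE [in RHS]/modz; ring.
  have [h1 h1g h1v] := link _ _ Lv Lw (or_introl vw).
  have [||h2 h2g h2w] := IHl w (- v) _ Lw _ wv.
  - have := modz_ge0 (form (e k) u) q0; have := ltz_mod (form (e k) u) q0.
    by rewrite -ew; lia.
  - by rewrite -scaleN1r; apply: LZ.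
  by exists (h2 * h1); [apply: goodM | rewrite actM h1v].
have [h1 h1g h1e] : exists2 h, good h & h *m (g *m e k) = e k.
  apply: (to_ek _ (g *m f k)); [exact: Lact | exact: Lact |].
  by rewrite form_isometry.
have [h1G _ _ h1f] := h1g.
pose f1 := h1 *m (g *m f k).
have Lf1 : L f1 by do 2?apply: (Lact) => //.
have ek_f1 : form (e k) f1 = 1 by rewrite -h1e !form_isometry.
(* This fixes [e k] and makes the image of [f1] pair to 1 with [f k]. The difference [f k - f2] is
   then unimodular and orthogonal to [e k], so that [h3] carries [f2] to [f k] and fixes [e k]. *)
pose h2 := transv (e k) (1 - form f1 (f k)).
have h2g : good h2 by apply: good_transv => //; exists (f k).
have h2f1 : h2 *m f1 = f1 + (1 - form f1 (f k)) *: e k.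
  by rewrite transvE ek_f1 mulr1.
have h2e : h2 *m e k = e k by rewrite transvE alt mulr0 scale0r addr0.
have [f2 f2E] : exists x, x = h2 *m f1 by exists (h2 *m f1).
have Lf2 : L f2 by rewrite f2E h2f1; apply: LD => //; apply: LZ.
have f2_fk : form f2 (f k) = 1 by rewrite f2E h2f1 !formE ek_fk; ring.
have ek_f2 : form (e k) f2 = 1 by rewrite f2E h2f1 !formE ek_f1 alt mulr0 addr0.
pose h3 := transv (f k - f2) (- 1).
have fk_f2 : form (f k) f2 = -1 by rewrite formC f2_fk.
have h3g : good h3.
  apply: good_transv; first by rewrite -scaleN1r; apply: LD => //; apply: LZ.
  by exists (- f k); rewrite !formE alt f2_fk.
have h3f2 : h3 *m f2 = f k.
  by rewrite transvE !formE alt fk_f2 subr0 mulrNN mulr1 scale1r addrC subrK.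
have h3e : h3 *m e k = e k.
  by rewrite transvE !formE formC ek_fk formC ek_f2 subrr mulr0 scale0r addr0.
have [hG hs hVs hf] : good (h3 * (h2 * h1)) by do 2?apply: (goodM).
set h := h3 * (h2 * h1) in hG hs hVs hf.
rewrite -(mulKr (isometry_unit hG) g); apply: spanM => //.
apply: (IH k.+1) => //; [lia | exact: GM |] => i.
rewrite ltnS leq_eqVlt => /predU1P[->|ik].
  by rewrite !actM h1e h2e h3e -/f1 -f2E h3f2.
by have [gei gfi] := gfix i ik; rewrite [h * g *m _]actM [h * g *m _]actM gei gfi; apply: hf.
Qed.

Lemma finitely_covered_isometry : finitely_covered N isometry.
Proof.
have Gspan g : isometry g <-> span g.
  split=> [gG|]; first by apply: (span_isometry (leq0n r)) => // i.
  exact: (word_spanG G_group NG CG).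
apply: (finitely_coveredS N_group _ _ (Y := span)).
- exact: isometry_unit.
- by move=> g /Gspan /isometry_unit.
- move=> g gG; exists g; first exact/Gspan.
  by rewrite mulVr ?isometry_unit //; case: N_group.
apply: (finitely_covered_word_span N_group G_group NG NJ M_gt0 CG).
- move=> g h gG [v [u vu] ->]; exists (g^-1 *m v); last first.
    by rewrite -{2}[g]invrK transv_conjV //; apply: isometryV.
  by exists (g^-1 *m u); rewrite form_isometry //; apply: isometryV.
- move=> g [v _ ->]; rewrite transvX // natz -[M%:Z]mulr1.
  exact: transv_in_group.
exact: finitely_covered_unimodular.
Qed.

End Basis.

(** * From root elements to powers of all transvections *)

Variables (r : nat) (e f : nat -> 'cV[int]_n.+1).
Hypotheses (ef_basis : symplectic_basis r e f) (r_ge2 : (1 < r)%N).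

Theorem finite_index_of_unipotents H (m : int) :
    unit_subgroup H -> 0 < m ->
    (forall x, form (e 0) x = 0 -> form (f 0) x = 0 ->
      H (etransv (e 0) x m) /\ H (etransv (f 0) x m)) ->
  finitely_covered H isometry.
Proof.
move=> H_group m_gt0 Hx; have [Hu H1 HM HV] := H_group.
have [ef1 orth _] := ef_basis.
have ef0 : form (e 0) (f 0) = 1 by apply/ef1/ltnW.
have [e01 ef01 fe01 ff01] := orth _ _ (ltnW r_ge2) r_ge2 isT.
have He x k : form (e 0) x = 0 -> form (f 0) x = 0 -> H (etransv (e 0) x (m * k)).
  move=> ex fx; rewrite mulrC -etransvZ.
  by apply: (proj1 (Hx _ _ _)); rewrite formE ?ex ?fx mulr0.
have Hf x k : form (e 0) x = 0 -> form (f 0) x = 0 -> H (etransv (f 0) x (m * k)).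
  move=> ex fx; rewrite mulrC -etransvZ.
  by apply: (proj2 (Hx _ _ _)); rewrite formE ?ex ?fx mulr0.
(* By symmetry of [etransv], the elements attached to [e 0] and [f 0] also lie in the Heisenberg
   group of [x], and their commutator is central there. *)
have HT x k : form (e 0) x = 0 -> form (f 0) x = 0 -> H (transv x (2 * m ^+ 2 * k)).
  move=> ex fx; have xe : form x (e 0) = 0 by rewrite formC ex oppr0.
  have xf : form x (f 0) = 0 by rewrite formC fx oppr0.
  have := etransv_comm alt (m * 1) (m * k) xe xf; rewrite ef0.
  have -> : 2 * (m * 1) * (m * k) * 1 = 2 * m ^+ 2 * k by ring.
  move=> <-; rewrite 2!(etransvC _ x).
  by apply: (HM); [apply: (HM) | apply: HV; apply: (HM)]; first [exact: He | exact: Hf].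
pose plane p q := p *: e 0 + q *: f 0.
have HE x p q k : form (e 0) x = 0 -> form (f 0) x = 0 ->
    H (etransv x (plane p q) (2 * m ^+ 2 * k)).
  move=> ex fx; have xe : form x (e 0) = 0 by rewrite formC ex oppr0.
  have xf : form x (f 0) = 0 by rewrite formC fx oppr0.
  pose s := 2 * m ^+ 2 * k * p; pose t := 2 * m ^+ 2 * k * q.
  have st : s *: e 0 + t *: f 0 = (2 * m ^+ 2 * k) *: plane p q.
    by rewrite scalerDr !scalerA.
  have := etransvD alt s t xe xf; rewrite ef0 st -etransv1 => E.
  rewrite -[etransv x _ _](mulrK (transv_unit alt x (s * t * 1))) -E.
  apply: (HM); [apply: (HM) |].
  - have -> : s = m * (2 * m * k * p) by rewrite /s; ring.
    by rewrite etransvC; apply: He.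
  - have -> : t = m * (2 * m * k * q) by rewrite /t; ring.
    by rewrite etransvC; apply: Hf.
  have -> : s * t * 1 = 2 * m ^+ 2 * (2 * m ^+ 2 * k ^+ 2 * p * q) by rewrite /s /t; ring.
  by apply: HV; apply: HT.
(* A commutator in the directions [e 1] and [f 1], both at level [2 * m ^+ 2]; it doubles the
   product of the levels. *)
have HP p q k : H (transv (plane p q) (8 * m ^+ 4 * k)).
  have ae : form (plane p q) (e 1) = 0 by rewrite !formE e01 fe01 !mulr0.
  have af : form (plane p q) (f 1) = 0 by rewrite !formE ef01 ff01 !mulr0.
  have := etransv_comm alt (2 * m ^+ 2 * 1) (2 * m ^+ 2 * k) ae af; rewrite ef1 //.
  have -> : 2 * (2 * m ^+ 2 * 1) * (2 * m ^+ 2 * k) * 1 = 8 * m ^+ 4 * k by ring.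
  move=> <-; rewrite 2!(etransvC _ (plane p q)).
  by apply: (HM); [apply: (HM) | apply: HV; apply: (HM)]; apply: HE.
have HV' v k : H (transv v (8 * m ^+ 4 * k)).
  (* The component of [v] on the first plane and its orthogonal rest, to be recombined by
     [transvDe]. *)
  pose a := plane (form v (f 0)) (form (e 0) v); pose x := v - a.
  have ex : form (e 0) x = 0 by rewrite !formE alt ef0; ring.
  have fx : form (f 0) x = 0.
    by rewrite !formE alt (formC _ v) (formC (f 0) (e 0)) ef0; ring.
  have ax : form a x = 0 by rewrite formDl !formZl ex fx !mulr0.
  have -> : v = a + x by rewrite addrC subrK.
  rewrite transvDe //; apply: (HM); [apply: (HM); first exact: HP |].
    have -> : 8 * m ^+ 4 * k = 2 * m ^+ 2 * (4 * m ^+ 2 * k) by ring.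
    exact: HT.
  have -> : 8 * m ^+ 4 * k = 2 * m ^+ 2 * (4 * m ^+ 2 * k) by ring.
  by rewrite etransvC; apply: HE.
pose M := absz (8 * m ^+ 4).
have ME : M%:Z = 8 * m ^+ 4 by rewrite gez0_abs // mulr_ge0 ?exprn_ge0 ?ltW.
have M_gt0 : (0 < M)%N by rewrite absz_gt0 mulf_neq0 // expf_neq0 // gt_eqF.
have NH g : transv_group M g -> H g.
  case=> w ->; elim: w => [|p w IH]; first by rewrite big_nil.
  by rewrite big_cons; apply: HM => //; rewrite ME.
have [I [t tP]] := finitely_covered_isometry ef_basis r_ge2 M_gt0.
by exists I, t => g /tP[i [Gi /NH Ni]]; exists i.
Qed.

Lemma subgroup_etransv H a b s k : unit_subgroup H -> form a b = 0 ->
  H (etransv a b s) -> H (etransv a b (s * k)).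
Proof.
move=> [_ H1 HM HV] ab Hab; have Hpos (j : nat) : H (etransv a b (s * j%:Z)).
  elim: j => [|j IH]; first by rewrite mulr0 etransv1 scale0r etransv0.
  have -> : etransv a b (s * j.+1) = etransv a b s * etransv a b (s * j).
    rewrite etransvD // alt mulr0 transv0 mulr1 -scalerDl -etransv1.
    by congr etransv; rewrite intS; ring.
  exact: HM.
by case: k => j //; rewrite NegzE mulrN -etransvV //; apply: HV.
Qed.

(** Adding directions costs a central term. At level [2 * m] this term is a multiple of
    [2 * m ^+ 2], which the commutator in the directions [e 1] and [f 1] supplies; hence the doubled
    level. *)
Lemma etransv_of_basis H a m : unit_subgroup H ->
    (forall i, (0 < i < r)%N -> [/\ form a (e i) = 0, form a (f i) = 0,
      H (etransv a (e i) m) & H (etransv a (f i) m)]) ->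
  forall x, form (e 0) x = 0 -> form (f 0) x = 0 -> H (etransv a x (2 * m)).
Proof.
move=> H_group Ha x e0x f0x; have [Hu H1 HM HV] := H_group.
have [ef1 orth nondeg] := ef_basis.
have [ae1 af1 He1 Hf1] := Ha 1%N r_ge2.
have HT k : H (transv a (2 * m ^+ 2 * k)).
  have := etransv_comm alt m (m * k) ae1 af1; rewrite ef1 //.
  have -> : 2 * m * (m * k) * 1 = 2 * m ^+ 2 * k by ring.
  have Hfk := subgroup_etransv k H_group af1 Hf1.
  by move=> <-; apply: (HM); [apply: (HM) | apply: HV; apply: (HM)].
have HD y z : form a y = 0 -> form a z = 0 -> H (etransv a y (2 * m)) ->
    H (etransv a z (2 * m)) -> H (etransv a (y + z) (2 * m)).
  move=> ay az Hy Hz; have := etransvD alt (2 * m) (2 * m) ay az.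
  rewrite -scalerDr -etransv1 => E; set t := _ * form y z in E.
  rewrite -[etransv a (y + z) _](mulrK (transv_unit alt a t)) -E.
  apply: (HM); first exact: HM.
  have -> : t = 2 * m ^+ 2 * (2 * form y z) by rewrite /t; ring.
  exact/HV/HT.
suff [] : form a x = 0 /\ H (etransv a x (2 * m)) by [].
have H0 : form a 0 = 0 /\ H (etransv a 0 (2 * m)) by rewrite etransv0 form0r.
have [k kr] : exists2 k, (k <= r)%N & forall i, (k <= i < r)%N ->
    form (e i) x = 0 /\ form (f i) x = 0.
  by exists r => // i; rewrite ltnNge andbN.
elim: k x kr e0x f0x => [|k IH] x kr e0x f0x xk.
  by rewrite (nondeg x) // => i ir; apply: xk.
(* The first plane contributes nothing, since [x] is orthogonal to it. *)
have [k0|k0] := eqVneq k 0%N.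
  rewrite (nondeg x) // => i ir; have [->//|i0] := eqVneq i 0%N.
  by apply: xk; rewrite k0 lt0n i0.
have k_lt : (0 < k < r)%N by rewrite lt0n k0.
have [aek afk Hek Hfk] := Ha k k_lt.
pose z := form x (f k) *: e k + form (e k) x *: f k.
have az t b : form a b = 0 -> H (etransv a b m) ->
    form a (t *: b) = 0 /\ H (etransv a (t *: b) (2 * m)).
  move=> ab Hb; rewrite formE ab mulr0 etransvZ; split=> //.
  by rewrite (_ : t * (2 * m) = m * (2 * t)); [apply: subgroup_etransv | ring].
have [az1 Hz1] := az (form x (f k)) _ aek Hek.
have [az2 Hz2] := az (form (e k) x) _ afk Hfk.
have az0 : form a z = 0 by rewrite formDr az1 az2 addr0.
have Hz : H (etransv a z (2 * m)) by apply: HD.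
have orthk i : (i < r)%N -> i != k -> form (e i) z = 0 /\ form (f i) z = 0.
  move=> ir ik; have [ee ef_ fe ff] := orth i k ir kr ik.
  by rewrite !formE ee ef_ fe ff !mulr0 !addr0.
have [e0z f0z] : form (e 0) z = 0 /\ form (f 0) z = 0.
  by apply: orthk; rewrite 1?eq_sym // ltnW.
suff [axz Hxz] : form a (x - z) = 0 /\ H (etransv a (x - z) (2 * m)).
  by rewrite -(subrK z x) formDr axz az0 addr0; split=> //; apply: HD.
apply: IH; [exact: ltnW | by rewrite formDr formNr e0x e0z subrr
  | by rewrite formDr formNr f0x f0z subrr |].
move=> i /andP[ki ir]; have [->|ik] := eqVneq i k.
  rewrite !formE !alt (formC (f k) x) (formC (f k) (e k)) ef1 //; split; ring.
have [eiz fiz] := orthk i ir ik; have [|eix fix_] := xk i.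
  by rewrite ir ltn_neqAle eq_sym ik ki.
by rewrite !formDr !formNr eiz fiz eix fix_ !subr0.
Qed.

Theorem finite_index_of_root_elements H (m : int) :
    unit_subgroup H -> 0 < m ->
    (forall i, (0 < i < r)%N ->
      [/\ H (etransv (e 0) (e i) m), H (etransv (e 0) (f i) m),
          H (etransv (f 0) (e i) m) & H (etransv (f 0) (f i) m)]) ->
  finitely_covered H isometry.
Proof.
move=> H_group m_gt0 Hi; have [_ orth _] := ef_basis.
apply: (finite_index_of_unipotents (m := 2 * m)) => //; first by rewrite mulr_gt0.
have r_gt0 := ltnW r_ge2.
have orth0 i : (0 < i < r)%N -> [/\ form (e 0) (e i) = 0, form (e 0) (f i) = 0,
    form (f 0) (e i) = 0 & form (f 0) (f i) = 0].
  by case/andP=> i0 ir; apply: orth; rewrite // eq_sym -lt0n.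
by move=> x ex fx; split; apply: etransv_of_basis => // i ir;
   have [? ? ? ?] := orth0 i ir; have [? ? ? ?] := Hi i ir.
Qed.

End FiniteIndex.

(** * From finite covers to arithmeticity *)

Section ChangeOfLattice.

Variables (n : nat) (Omega J P : 'M[int]_n.+1) (D : nat).
Hypotheses (J_unit : J \in unitmx) (D_gt0 : (0 < D)%N).
Hypothesis PJ : P^T *m Omega *m P = D%:Z *: J.
Implicit Types X Y g : 'M[int]_n.+1.

Variable Gamma : 'M[int]_n.+1 -> Prop.
Hypothesis Gamma_group : unit_subgroup Gamma.

(** The elements of [Gamma] that preserve the lattice spanned by the columns of [P], written in that
    basis. *)
Definition conj_subgroup X := isometry J X /\ exists2 Y, Gamma Y & Y * P = P * X.

Let D_neq0 : D%:Z != 0. Proof. by lia. Qed.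

(** The scaled form gives a left inverse of [P] up to [D]. It is also a right one, as [P] can be
    cancelled by its adjugate. So [D] times the full lattice lies in the sublattice. *)
Lemma lattice_inverse : exists P', P *m P' = D%:Z%:M.
Proof.
pose P' := invmx J *m P^T *m Omega.
have P'P : P' *m P = D%:Z%:M.
  by rewrite /P' -!mulmxA (mulmxA P^T) PJ -scalemxAr mulVmx // scalemx1.
exists P'; have P0 : \det P != 0.
  have := congr1 determinant P'P; rewrite det_mulmx det_scalar => /eqP.
  by apply: contraTneq => ->; rewrite mulr0 eq_sym expf_neq0.
have : (P *m P' - D%:Z%:M) *m P *m \adj P = 0.
  by rewrite mulmxBl -(mulmxA P) P'P mul_mx_scalar mul_scalar_mx subrr mul0mx.
rewrite -mulmxA mul_mx_adj mul_mx_scalar => /matrixP PP'E.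
apply/eqP; rewrite -subr_eq0; apply/eqP/matrixP => i j.
have := PP'E i j; rewrite [in LHS]mxE => /eqP; rewrite [in X in _ == X]mxE mulf_eq0 (negPf P0).
by move=> /eqP ->; rewrite mxE.
Qed.

Let mulPI X Y : X * P = Y * P -> X = Y.
Proof.
have [P' PP'] := lattice_inverse; move=> /(congr1 (mulmx^~ P')).
rewrite -!mulmxA PP' !mul_mx_scalar => /matrixP XY.
by apply/matrixP => i j; have := XY i j; rewrite !mxE => /(mulfI D_neq0).
Qed.

Lemma conj_subgroup_group : unit_subgroup conj_subgroup.
Proof.
have [Gu G1 GM GV] := Gamma_group.
split.
- by move=> X [[]].
- by split; [apply: isometry1 | exists 1; rewrite ?mul1r ?mulr1].
- move=> X X' [XJ [Y GY YP]] [X'J [Y' GY' Y'P]]; split; first exact: isometryM.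
  by exists (Y * Y'); [apply: GM | rewrite -mulrA Y'P !mulrA YP].
move=> X [XJ [Y GY YP]]; split; first exact: isometryV.
have [Xu _] := XJ; exists Y^-1; first exact: GV.
by apply: (mulrI (Gu _ GY)); rewrite mulrA mulrV ?Gu // mul1r mulrA YP mulrK.
Qed.

(** The isometries congruent to 1 modulo [D] have finitely many cosets and preserve the sublattice,
    hence can be compared there with the cosets of [conj_subgroup]. *)
Lemma finitely_covered_lattice :
  finitely_covered conj_subgroup (isometry J) -> finitely_covered Gamma (isometry Omega).
Proof.
have [Gu G1 GM GV] := Gamma_group; have [P' PP'] := lattice_inverse.
move=> [I [t tP]].
pose K g := isometry Omega g /\ exists Z, g = 1 + D%:Z *: Z.
have Iu g : isometry Omega g -> g \is a GRing.unit by case.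
apply: (@finitely_covered_trans _ _ K) => //.
- exact: isometryM.
- by move=> g [].
- apply: (@finitely_covered_color _ _ _ _ (fun g i => mxmod D g = i)) => [g _|].
    by exists (mxmod D g).
  move=> g h i gJ hJ <- /esym/(mxmod_eq D_gt0)[Z hE].
  split; first by apply: isometryM => //; apply: isometryV.
  by exists (g^-1 * Z); rewrite hE mulrDr mulVr ?Iu // scalerAr.
pose c g i := exists X, g * P = P * (t i * X) /\ conj_subgroup X.
have KX g : K g -> exists2 X, isometry J X & g * P = P * X.
  (* Because [D%:Z *: (Z * P)] is [P * (P' * Z * P)]. *)
  move=> [[_ gO] [Z gE]]; exists (1 + P' * Z * P); last first.
    rewrite gE mulrDl mulrDr mul1r mulr1 !mulrA -mulmxE PP' mul_scalar_mx.
    by rewrite -scalemxAl.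
  have gP : g *m P = P *m (1 + P' * Z * P).
    rewrite gE mulmxDl mulmxDr mul1mx mulmx1 !mulmxA PP' mul_scalar_mx.
    by rewrite -scalemxAl.
  set X := 1 + _ in gP *; apply: isometryP => //.
  suff : D%:Z *: (X^T *m J *m X) = D%:Z *: J.
    move=> /matrixP XJ; apply/matrixP => i j; have := XJ i j.
    by rewrite mxE [RHS]mxE => /(mulfI D_neq0).
  rewrite -PJ scalemxAl scalemxAr -PJ !mulmxA -trmx_mul -gP -!mulmxA -gP.
  by rewrite trmx_mul -{2}gO !mulmxA.
apply: (@finitely_covered_color _ _ I _ c) => [g /KX[X XJ gP]|].
  have [i [ti tiX]] := tP X XJ; exists i, ((t i)^-1 * X).
  by rewrite mulVKr //; case: ti.
move=> g h i [gO _] _ [X [gP [XJ [Y GY YP]]]] [X' [hP [X'J [Y' GY' Y'P]]]].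
have [Xu _] := XJ; have Yu := Gu _ GY.
suff -> : h = g * (Y^-1 * Y') by rewrite mulKr ?Iu //; apply: GM => //; apply: GV.
have YVP : Y^-1 * P = P * X^-1.
  by apply: (mulrI Yu); rewrite mulrA mulrV // mul1r mulrA YP mulrK.
apply: mulPI; rewrite hP -!mulrA Y'P [Y^-1 * _]mulrA YVP !mulrA gP !mulrA.
by rewrite mulrK.
Qed.

End ChangeOfLattice.

(** * Zariski closure and integral points *)

Section Arithmetic.
Local Open Scope classical_set_scope.

Variables (K : numFieldType) (n : nat) (Omega A B : 'M[int]_n.+1).
Hypotheses (A_iso : isometry Omega A) (B_iso : isometry Omega B).
Implicit Types (X Y g : 'M[int]_n.+1).

Local Notation toK := (map_mx (intr : int -> K)).

Lemma map_intr_inj p q : injective (map_mx (intr : int -> K) : 'M_(p, q) -> 'M_(p, q)).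
Proof.
move=> X Y /matrixP XY; apply/matrixP => i j; have := XY i j.
by rewrite !mxE => /intr_inj.
Qed.

Lemma map_intr_unitmx g : g \is a GRing.unit -> toK g \in unitmx.
Proof. by move=> gu; rewrite unitmxE det_map_mx rmorph_unit. Qed.

Lemma map_intr_invmx g : g \is a GRing.unit -> toK g^-1 = invmx (toK g).
Proof. by move=> gu; rewrite -[toK _]/(map_mx _ _) rmorphV. Qed.

Definition generated : set 'M[K]_n.+1 :=
  smallest (@subgroup_GL K n.+1) [set toK A; toK B].

Lemma generated_subgroup : subgroup_GL generated.
Proof.
split.
- move=> M GM; apply: (GM (@GL K n.+1)).
  split; last by move=> N [->|->]; apply: map_intr_unitmx; [case: A_iso | case: B_iso].
  split=> //; first exact: unitmx1.
  - by move=> M1 M2; rewrite /GL /= unitmx_mul => -> ->.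
  - by move=> M1; rewrite /GL /= unitmx_inv.
- by move=> H [[]].
- by move=> M1 M2 GM1 GM2 H HH; have [[_ _ + _] _] := HH; apply; [apply: GM1 | apply: GM2].
- by move=> M1 GM1 H HH; have [[_ _ _ +] _] := HH; apply; apply: GM1.
Qed.

Definition int_points g := isometry Omega g /\ generated (toK g).

Lemma int_points_gen : int_points A /\ int_points B.
Proof. by split; split=> // H [_]; apply; [left|right]. Qed.

Lemma int_points_group : unit_subgroup int_points.
Proof.
have [_ G1 GM GV] := generated_subgroup.
split.
- by move=> X [[]].
- by split; [apply: isometry1 | rewrite map_mx1].
- move=> X Y [XJ GX] [YJ GY]; split; first exact: isometryM.
  by rewrite map_mxM; apply: GM.
move=> X [XJ GX]; split; first exact: isometryV.
by rewrite map_intr_invmx; [apply: GV | case: XJ].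
Qed.

Lemma generated_int M : generated M -> exists2 g, isometry Omega g & M = toK g.
Proof.
move=> GM; apply: (GM [set M | exists2 g, isometry Omega g & M = toK g]).
split; last by move=> _ [->|->]; [exists A | exists B].
split.
- by move=> _ [g [gu _] ->]; apply: map_intr_unitmx.
- by exists 1; [apply: isometry1 | rewrite map_mx1].
- move=> _ _ [g gJ ->] [h hJ ->]; exists (g * h); first exact: isometryM.
  by rewrite map_mxM.
move=> _ [g gJ ->]; exists g^-1; first exact: isometryV.
by rewrite map_intr_invmx //; case: gJ.
Qed.

(** The closure of the group is thus contained in the symplectic group of [Omega], and a finite
    cover of the integral points of the latter also covers those of the closure. *)
Lemma zariski_closed_isometry :
  zariski_closed [set M : 'M[K]_n.+1 | GL M /\ M^T *m toK Omega *m M = toK Omega].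
Proof.
pose x i j := mpoly.mpolyX K (mpoly.mnm1 (mxvec_index i j) : mpoly.multinom (n.+1 * n.+1)).
pose p i j := \sum_l (\sum_k x k i * mpoly.mpolyC _ (toK Omega k l)) * x l j
  - mpoly.mpolyC _ (toK Omega i j).
have pE (M : 'M[K]_n.+1) i j : mpoly.meval (fun k => mxvec M 0 k) (p i j) =
    (M^T *m toK Omega *m M) i j - toK Omega i j.
  rewrite /p rmorphB rmorph_sum /= mpoly.mevalC; congr (_ - _).
  rewrite mxE; apply: eq_bigr => l _; rewrite rmorphM rmorph_sum /=.
  rewrite mpoly.mevalXU mxvecE; congr (_ * _).
  rewrite mxE; apply: eq_bigr => k _; rewrite rmorphM /=.
  by rewrite mpoly.mevalXU mpoly.mevalC mxvecE [M^T _ _]mxE.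
exists [set q | exists i j, q = p i j]; apply/seteqP; split=> M /= [GM MO]; split=> //.
  by move=> _ [i [j ->]]; rewrite pE MO subrr.
apply/matrixP => i j; apply/eqP; rewrite -subr_eq0 -pE; apply/eqP.
by apply: MO; exists i, j.
Qed.

Lemma arithmetic_of_finitely_covered :
  finitely_covered int_points (isometry Omega) -> arithmetic generated.
Proof.
move=> [I [t tP]]; have [genGL G1 GM GV] := generated_subgroup.
have closure_int M : zariski_closure generated M -> @GL_int K n.+1 M ->
    exists2 g, isometry Omega g & M = toK g.
  move=> clM [g gu gM]; exists g => //.
  have := clM _ (conj zariski_closed_isometry _); rewrite -gM; case.
    move=> _ /generated_int[h [hu hO] ->]; split; first exact: map_intr_unitmx.
    by rewrite !map_trmx -!map_mxM hO.
  move=> _; rewrite !map_trmx -!map_mxM => /map_intr_inj gO; split=> //.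
split.
  move=> M GenM; split.
    by apply: sub_gen_smallest.
  have [g [gu _] ->] := generated_int GenM; exists g => //.
pose coset g := [set toK g *m h | h in generated].
apply: (@sub_finite_set _ _ (range (fun i : I => coset (t i)))); last first.
  exact: finite_image.
move=> _ [M [clM intM] <-]; have [g gO ->] := closure_int M clM intM.
have [i [[tu _] [_ Gi]]] := tP g gO; exists i => //; rewrite /coset.
have tKu := map_intr_unitmx tu.
rewrite map_mxM map_intr_invmx // in Gi.
have gE := mulKVmx tKu (toK g); set x := _ *m toK g in Gi gE.
have xu : x \in unitmx by apply: genGL.
apply/seteqP; split=> _ [h Gh <-]; rewrite -gE.
  exists (invmx x *m h); first by apply: GM => //; apply: GV.
  by rewrite -mulmxA mulKVmx.
by exists (x *m h); [apply: GM | rewrite mulmxA].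
Qed.

End Arithmetic.

(** * Cyclotomic factors *)

Definition root_factor (R : realType) (a : rat) : {poly R[i]} :=
  'X - (exp2pii R a)%:P.

Section RootsOfUnity.

Variable R : realType.
Local Notation E := (exp2pii R).
Local Notation factor := (root_factor R).

Lemma exp2piiD a b : E (a + b) = E a * E b.
Proof.
rewrite /exp2pii rmorphD mulrDr cosD sinD /= [in RHS]mulrC.
by simpc; congr Complex; ring.
Qed.

Lemma exp2pii0 : E 0 = 1.
Proof. by rewrite /exp2pii rmorph0 mulr0 cos0 sin0. Qed.

Lemma exp2piiMn a k : E (k%:R * a) = E a ^+ k.
Proof.
elim: k => [|k IH]; first by rewrite mul0r exp2pii0.
by rewrite exprS -IH -exp2piiD mulrSr mulrDl mul1r addrC.
Qed.

Lemma exp2pii_half : E (1 / 2) = -1.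
Proof.
rewrite /exp2pii rmorphM rmorph1 mul1r fmorphV rmorph_nat mulrAC divff ?pnatr_eq0 //.
by rewrite mul1r cospi sinpi -[X in Complex _ X]oppr0.
Qed.

(** The cube is -1, and the factor [z + 1] of [z ^+ 3 + 1] can be cancelled because the imaginary
    part of [z] is positive. The relations for orders 3, 4, 9 and 12 are derived from this one. *)
Lemma exp2pii_sixth : E (1 / 6) ^+ 2 = E (1 / 6) - 1.
Proof.
set z := E _; have z3 : z ^+ 3 = -1 by rewrite -exp2piiMn -exp2pii_half; congr E.
have z_neq : z + 1 != 0.
  rewrite eq_complex /= negb_and orbC addr0 gt_eqF // sin_gt0_pi //.
  rewrite !rmorphM rmorph1 mul1r fmorphV rmorph_nat.
  have := pi_gt0 R; set p := pi => p0.
  have -> : 2 * p / 6 = p / 3 by field.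
  by rewrite divr_gt0 //= ltr_pdivrMr // ltr_pMr // ltr1n.
have : (z + 1) * (z ^+ 2 - (z - 1)) = z ^+ 3 + 1 by ring.
rewrite z3 addNr => /eqP; rewrite mulf_eq0 (negPf z_neq) /=.
by rewrite subr_eq0 => /eqP.
Qed.

Lemma exp2pii_pow k (a b : rat) : b = k%:R * a -> E b = E a ^+ k.
Proof. by move=> ->; apply: exp2piiMn. Qed.

Lemma mulXsubC (a b s p : R[i]) : a + b = s -> a * b = p ->
  ('X - a%:P) * ('X - b%:P) = 'X^2 - s%:P * 'X + p%:P.
Proof. by move=> <- <-; rewrite polyCD polyCM; ring. Qed.

Lemma cyclotomic_poly3 :
  factor (1 / 3) * factor (2 / 3) = 'X^2 + 'X + 1.
Proof.
rewrite /root_factor.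
have z2 := exp2pii_sixth; set z := E (1 / 6) in z2.
rewrite (@exp2pii_pow 2 (1 / 6) (1 / 3)) // (@exp2pii_pow 4 (1 / 6) (2 / 3)) // -/z.
rewrite (@mulXsubC _ _ (-1) 1); first by rewrite polyCN polyC1; ring.
- by ring: z2.
by ring: z2.
Qed.

Lemma cyclotomic_poly6 :
  factor (1 / 6) * factor (5 / 6) = 'X^2 - 'X + 1.
Proof.
rewrite /root_factor.
have z2 := exp2pii_sixth; rewrite (@exp2pii_pow 5 (1 / 6) (5 / 6)) //.
rewrite (@mulXsubC _ _ 1 1); first by rewrite polyC1; ring.
- by ring: z2.
by ring: z2.
Qed.

Lemma exp2pii_twelfth : E (1 / 12) ^+ 4 = E (1 / 12) ^+ 2 - 1.
Proof.
by have := exp2pii_sixth; rewrite (@exp2pii_pow 2 (1 / 12) (1 / 6)) // -exprM.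
Qed.

Lemma cyclotomic_poly4 :
  factor (1 / 4) * factor (3 / 4) = 'X^2 + 1.
Proof.
rewrite /root_factor.
have z4 := exp2pii_twelfth.
rewrite (@exp2pii_pow 3 (1 / 12) (1 / 4)) // (@exp2pii_pow 9 (1 / 12) (3 / 4)) //.
rewrite (@mulXsubC _ _ 0 1); first by rewrite polyC0 polyC1; ring.
- by ring: z4.
by ring: z4.
Qed.

(** With [s = z + z ^+ 5], the two pairs give ['X^2 - s%:P * 'X - 1] and ['X^2 + s%:P * 'X - 1], and
    the square of [s] is -1. *)
Lemma cyclotomic_poly12 :
  factor (1 / 12) * factor (5 / 12) *
    (factor (7 / 12) * factor (11 / 12)) = 'X^4 - 'X^2 + 1.
Proof.
rewrite /root_factor.
have z4 := exp2pii_twelfth; set z := E (1 / 12) in z4 *.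
rewrite (@exp2pii_pow 5 (1 / 12) (5 / 12)) // (@exp2pii_pow 7 (1 / 12) (7 / 12)) //.
rewrite (@exp2pii_pow 11 (1 / 12) (11 / 12)) // -/z.
have -> : z ^+ 7 = - z by ring: z4.
have -> : z ^+ 11 = - z ^+ 5 by ring: z4.
rewrite (@mulXsubC _ _ (z + z ^+ 5) (-1)) //; last by ring: z4.
rewrite (@mulXsubC _ _ (- (z + z ^+ 5)) (-1)) //; [|ring|ring: z4].
have : (z + z ^+ 5) ^+ 2 = -1 by ring: z4.
set s := z + _ => s2; have sP : (s%:P * s%:P : {poly R[i]}) = -1.
  by rewrite -polyCM -expr2 s2 polyCN polyC1.
by rewrite !polyCN polyC1; ring: sP.
Qed.

Lemma exp2pii_ninth : E (1 / 9) ^+ 6 = - E (1 / 9) ^+ 3 - 1.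
Proof.
have z2 := exp2pii_sixth; have := @exp2pii_pow 2 (1 / 6) (1 / 3) erefl.
rewrite (@exp2pii_pow 3 (1 / 9) (1 / 3)) // => y3.
have -> : E (1 / 9) ^+ 6 = (E (1 / 9) ^+ 3) ^+ 2 by rewrite -exprM.
rewrite y3.
by ring: z2.
Qed.

Lemma cyclotomic_poly9 :
  factor (1 / 9) * factor (4 / 9) * factor (7 / 9) *
    (factor (2 / 9) * factor (5 / 9) * factor (8 / 9)) =
    'X^6 + 'X^3 + 1.
Proof.
rewrite /root_factor.
have y6 := exp2pii_ninth; set y := E (1 / 9) in y6 *.
rewrite (@exp2pii_pow 4 (1 / 9) (4 / 9)) // (@exp2pii_pow 7 (1 / 9) (7 / 9)) //.
rewrite (@exp2pii_pow 2 (1 / 9) (2 / 9)) // (@exp2pii_pow 5 (1 / 9) (5 / 9)) //.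
rewrite (@exp2pii_pow 8 (1 / 9) (8 / 9)) // -/y !(rmorphXn, polyC_exp).
have := congr1 polyC y6; rewrite polyCB polyCN !polyC_exp polyC1.
by set c := y%:P => c6; ring: c6.
Qed.

Lemma root_factor0 : factor 0 = 'X - 1.
Proof. by rewrite /root_factor exp2pii0 polyC1. Qed.

Lemma root_factor_half : factor (1 / 2) = 'X + 1.
Proof. by rewrite /root_factor exp2pii_half polyCN polyC1 opprK. Qed.

Lemma param_poly_prod n (a : n.-tuple rat) :
  param_poly R a = \prod_(x <- a) factor x.
Proof. by rewrite /param_poly big_tuple. Qed.

End RootsOfUnity.

(** * Certificates *)

(* Integer matrices as lists of rows of binary integers, for evaluation. *)
Definition zmx := seq (seq Z).

Definition zmx_mk (F : nat -> nat -> Z) : zmx := mkseq (fun i => mkseq (F i) 6) 6.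

Definition zmx_get (X : zmx) i j : Z := nth 0 (nth [::] X i) j.

Definition zmx_diag (c : Z) := zmx_mk (fun i j => if i == j then c else 0).

Definition zmx_tr X := zmx_mk (fun i j => zmx_get X j i).

Definition zmx_mul X Y := zmx_mk (fun i j =>
  foldr (fun k s => zmx_get X i k * zmx_get Y k j + s) 0 (iota 0 6)).

(** Binary powering, as exponents in the certificates exceed 41 million. *)
Fixpoint zmx_pow (X : zmx) (k : positive) : zmx :=
  match k with
  | xH => X
  | xO k' => let Y := zmx_pow X k' in zmx_mul Y Y
  | xI k' => let Y := zmx_pow X k' in zmx_mul X (zmx_mul Y Y)
  end.

Definition toM (X : zmx) : 'M[int]_6 := \matrix_(i, j) int_of_Z (zmx_get X i j).

Lemma zmx_get_mk F (i j : 'I_6) : zmx_get (zmx_mk F) i j = F i j.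
Proof. by rewrite /zmx_get /zmx_mk !nth_mkseq. Qed.

Lemma toM_mk F (i j : 'I_6) : toM (zmx_mk F) i j = int_of_Z (F i j).
Proof. by rewrite mxE zmx_get_mk. Qed.

Lemma toM_diag c : toM (zmx_diag c) = (int_of_Z c)%:M.
Proof. by apply/matrixP => i j; rewrite toM_mk mxE -val_eqE /=; case: eqP. Qed.

Lemma toM_tr X : toM (zmx_tr X) = (toM X)^T.
Proof. by apply/matrixP => i j; rewrite toM_mk !mxE. Qed.

Lemma toM_mul X Y : toM (zmx_mul X Y) = toM X *m toM Y.
Proof.
apply/matrixP => i j; rewrite toM_mk mxE.
rewrite (eq_bigr (fun k : 'I_6 => int_of_Z (zmx_get X i k * zmx_get Y k j))); last first.
  by move=> k _; rewrite !mxE rmorphM.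
rewrite -(big_mkord xpredT (fun k => int_of_Z (zmx_get X i k * zmx_get Y k j))).
rewrite /index_iota subn0; elim: (iota 0 6) => [|k s IH]; first by rewrite big_nil.
by rewrite big_cons -IH /= rmorphD.
Qed.

Lemma toM_pow X k : toM (zmx_pow X k) = toM X ^+ Pos.to_nat k.
Proof.
elim: k => [k IH|k IH|] /=; last by rewrite expr1.
  by rewrite !toM_mul IH Pos2Nat.inj_xI multE exprS mulnC exprM expr2.
by rewrite toM_mul IH Pos2Nat.inj_xO multE mulnC exprM expr2.
Qed.

Definition zmx_companion (s : seq Z) := zmx_mk (fun i j =>
  if j == 5 then - nth 0 s i else if i == j.+1 then 1 else 0).

(* The inverse companion matrix, for a constant coefficient and a leading
   coefficient equal to 1. *)
Definition zmx_companionV (s : seq Z) := zmx_mk (fun i j =>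
  if j == 0 then - nth 0 s i.+1 else if i.+1 == j then 1 else 0).

Definition zpoly (s : seq Z) : {poly int} := Poly (map int_of_Z s).

Lemma toM_companion s : toM (zmx_companion s) = companion 6 (zpoly s).
Proof.
apply/matrixP => i j; rewrite toM_mk mxE coef_Poly eqSS.
case: eqP => [_|_]; last by case: eqP.
rewrite rmorphN; congr (- _); case: (ltnP i (size s)) => [lt|ge].
  by rewrite (nth_map 0).
by rewrite !nth_default ?size_map.
Qed.

(** The standard form for the order [e_0, f_0, e_1, f_1, e_2, f_2]. *)
Definition zmx_J := zmx_mk (fun i j =>
  if (i./2 == j./2) && (i != j) then (if odd i then -1 else 1) else 0).

Section Words.

Variables f g : seq Z.

(* Capital letters are inverses. *)
Definition letter_zmx (c : ascii) : zmx :=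
  match c with
  | "a" => zmx_companion f | "A" => zmx_companionV f
  | "b" => zmx_companion g | "B" => zmx_companionV g
  | _ => zmx_diag 1
  end%char.

Definition swap_case (c : ascii) : ascii :=
  match c with
  | "a" => "A" | "A" => "a" | "b" => "B" | "B" => "b" | _ => c
  end%char.

Fixpoint word_zmx (w : string) : zmx :=
  match w with
  | EmptyString => zmx_diag 1
  | String c w => zmx_mul (letter_zmx c) (word_zmx w)
  end.

Fixpoint word_inv (w v : string) : string :=
  match w with
  | EmptyString => v
  | String c w => word_inv w (String (swap_case c) v)
  end.

Definition conj_word (u w : string) : string := (u ++ w ++ word_inv u "")%string.

Definition power_zmx (w : string) (k : Z) : zmx :=
  match k with
  | Z0 => zmx_diag 1
  | Zpos k => zmx_pow (word_zmx w) k
  | Zneg k => zmx_pow (word_zmx (word_inv w "")) k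
  end.

(* The word [Ab] is the transvection along [w]. *)
Definition pair_word (u : string * string) : string :=
  (conj_word u.2 "Ab" ++ conj_word u.1 "Ba")%string.

End Words.

Definition zmx_etransv (a b : nat) (m : Z) := zmx_mk (fun i j =>
  (if i == j then 1 else 0) + m * ((if i == a then zmx_get zmx_J b j else 0) +
                                   (if i == b then zmx_get zmx_J a j else 0))).

(* With [P] the matrix [cert_basis] and [d] its [cert_scale], [P^T Omega P = d J].
   Each pair of words [(x, y)] stands for the orbit vectors [u = x w] and
   [y w = +- (u + k w)]. The first four rows express the root elements of level
   [cert_level] attached to [e_0] and [e_1, f_1, e_2, f_2] by the exponents of the
   elements [pair_word] and, last, of [T_w]; the other four rows do the same for
   [f_0], after conjugation by the word [cert_conj]. *)
Record certificate := Certificate {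
  cert_f : seq Z;
  cert_g : seq Z;
  cert_form : zmx;
  cert_basis : zmx;
  cert_scale : positive;
  cert_level : positive;
  cert_pairs : seq (string * string);
  cert_conj : string;
  cert_rows : seq (seq Z * Z)
}.

Definition certificate_product (c : certificate) (u : string) (r : seq Z * Z) : zmx :=
  foldr (fun pk X => zmx_mul
      (power_zmx (cert_f c) (cert_g c) (conj_word u (pair_word pk.1)) pk.2) X)
    (power_zmx (cert_f c) (cert_g c) (conj_word u "Ab") r.2)
    (zip (cert_pairs c) r.1).

Definition certificate_check (c : certificate) : bool :=
  let A := zmx_companion (cert_f c) in let A' := zmx_companionV (cert_f c) in
  let B := zmx_companion (cert_g c) in let B' := zmx_companionV (cert_g c) in
  let Om := cert_form c in let P := cert_basis c in
  let m := Zpos (cert_level c) in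
  [&& zmx_mul A A' == zmx_diag 1, zmx_mul B B' == zmx_diag 1,
      zmx_mul (zmx_mul (zmx_tr A) Om) A == Om, zmx_mul (zmx_mul (zmx_tr B) Om) B == Om,
      zmx_mul (zmx_mul (zmx_tr P) Om) P == zmx_mul (zmx_diag (Zpos (cert_scale c))) zmx_J
    (* The indices [b.+2] run through [e_1, f_1, e_2, f_2]. The equations are multiplied by [P],
       whose inverse need not be integral. *)
    & all (fun b =>
        (zmx_mul (certificate_product c "" (nth ([::], 0) (cert_rows c) b)) P ==
          zmx_mul P (zmx_etransv 0 b.+2 m)) &&
        (zmx_mul (certificate_product c (cert_conj c) (nth ([::], 0) (cert_rows c) (b + 4))) P ==
          zmx_mul P (zmx_etransv 1 b.+2 m))) (iota 0 4)].

Definition toJ : 'M[int]_6 := toM zmx_J.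
Definition basis_e (i : nat) : 'cV[int]_6 := delta_mx (inord i.*2) 0.
Definition basis_f (i : nat) : 'cV[int]_6 := delta_mx (inord i.*2.+1) 0.

Lemma form_delta (J : 'M[int]_6) (a b : 'I_6) :
  form J (delta_mx a 0) (delta_mx b 0) = J a b.
Proof. by rewrite /form trmx_delta -rowE -colE !mxE. Qed.

Lemma form_deltal (J : 'M[int]_6) (a : 'I_6) x : form J (delta_mx a 0) x = (J *m x) a 0.
Proof. by rewrite /form trmx_delta -mulmxA -rowE mxE. Qed.

Lemma toJ_tr : toJ^T = - toJ.
Proof.
rewrite -toM_tr (_ : zmx_tr zmx_J = zmx_mul (zmx_diag (-1)) zmx_J); last by vm_compute.
by rewrite toM_mul toM_diag mul_scalar_mx scaleN1r.
Qed.

Lemma toJ_unit : toJ \in unitmx.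
Proof.
have : toJ *m (- toJ) = 1%:M.
  by rewrite -toJ_tr -toM_tr -toM_mul -[RHS](toM_diag 1); congr toM; vm_compute.
by move=> /mulmx1_unit[].
Qed.

Lemma toJ_alt x : form toJ x x = 0.
Proof.
have E : (x^T *m toJ *m x)^T = - (x^T *m toJ *m x).
  by rewrite !trmx_mul trmxK toJ_tr mulNmx mulmxN mulmxA.
by have /matrixP/(_ 0 0) := E; rewrite [LHS]mxE [RHS]mxE -/(form toJ x x); lia.
Qed.

Lemma toJ_basis : symplectic_basis toJ 3 basis_e basis_f.
Proof.
split.
- by move=> [|[|[|i]]] // _; rewrite form_delta toM_mk !inordK.
- by move=> [|[|[|i]]] [|[|[|j]]] // _ _ _; rewrite !form_delta !toM_mk !inordK.
move=> x x0; suff Jx : toJ *m x = 0 by rewrite -(mulKmx toJ_unit x) Jx mulmx0.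
apply/colP => i; rewrite [RHS]mxE.
have i2 : (i./2 < 3)%N by case: i => [] [|[|[|[|[|[|]]]]]].
have [] := x0 _ i2; rewrite !form_deltal => ei fi.
rewrite -(inord_val i) -(odd_double_half i).
by case: (odd i); rewrite ?add1n ?add0n.
Qed.

Lemma etransv_delta (a b : 'I_6) m :
  etransv toJ (delta_mx a 0) (delta_mx b 0) (int_of_Z m) = toM (zmx_etransv a b m).
Proof.
have outer (c d : 'I_6) : (delta_mx c 0 : 'cV_6) *m ((delta_mx d 0 : 'cV_6)^T *m toJ) =
    \matrix_(i, j) (if i == c then toJ d j else 0).
  apply/matrixP => i j; rewrite trmx_delta -rowE mxE big_ord1 !mxE.
  by rewrite andbT; case: eqP => _; rewrite ?mul1r ?mul0r.
apply/matrixP => i j; rewrite /etransv !outer toM_mk !mxE -!val_eqE /=.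
rewrite !(rmorphD, rmorphM) /=; congr (_ + _ * (_ + _)).
- by case: eqP.
- by case: eqP.
by case: eqP.
Qed.

Lemma map_companion (K : nzRingType) (p : {poly int}) n :
  companion n (map_poly intr p : {poly K}) = map_mx intr (companion n p).
Proof.
apply/matrixP => i j; rewrite !mxE; case: eqP => _; last by rewrite rmorph_nat.
by rewrite coef_map rmorphN.
Qed.

Section Soundness.

Variables (R : realType) (alpha beta : 6.-tuple rat) (c : certificate).
Hypotheses (alphaE : param_poly R alpha = map_poly intr (zpoly (cert_f c)))
           (betaE : param_poly R beta = map_poly intr (zpoly (cert_g c))).
Hypothesis c_ok : certificate_check c.

Lemma certificate_sound : arithmetic (hypergeometric_group R alpha beta).
Proof.
pose A := toM (zmx_companion (cert_f c)); pose B := toM (zmx_companion (cert_g c)).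
pose Om := toM (cert_form c); pose P := toM (cert_basis c).
have -> : hypergeometric_group R alpha beta = @generated R[i] 5 A B.
  by rewrite /hypergeometric_group alphaE betaE !map_companion -!toM_companion.
case/and5P: c_ok => /eqP AA' /eqP BB' /eqP AOm /eqP BOm /andP[/eqP POm rows].
have {AA'} AA' : A * toM (zmx_companionV (cert_f c)) = 1.
  by rewrite -[LHS]toM_mul AA' toM_diag.
have {BB'} BB' : B * toM (zmx_companionV (cert_g c)) = 1.
  by rewrite -[LHS]toM_mul BB' toM_diag.
have {AOm} Aiso : isometry Om A.
  by split; [case/mulmx1_unit: AA' | rewrite -toM_tr -!toM_mul AOm].
have {BOm} Biso : isometry Om B.
  by split; [case/mulmx1_unit: BB' | rewrite -toM_tr -!toM_mul BOm].
have {POm} POm : P^T *m Om *m P = (Pos.to_nat (cert_scale c))%:Z *: toJ.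
  by rewrite -toM_tr -!toM_mul POm toM_mul toM_diag mul_scalar_mx.
apply: (arithmetic_of_finitely_covered Aiso Biso).
pose Gamma := int_points R[i] Om A B; rewrite -/Gamma.
have Ggroup : unit_subgroup Gamma by apply: int_points_group.
have [Gu G1 GM GV] := Ggroup.
have [GA GB] : Gamma A /\ Gamma B by apply: int_points_gen.
have GA' : Gamma (toM (zmx_companionV (cert_f c))).
  by rewrite -[toM _](mulKr (Gu _ GA)) AA' mulr1; apply: GV.
have GB' : Gamma (toM (zmx_companionV (cert_g c))).
  by rewrite -[toM _](mulKr (Gu _ GB)) BB' mulr1; apply: GV.
have G1' : Gamma (toM (zmx_diag 1)) by rewrite toM_diag.
(* A character is eight booleans; all those other than the four letters stand for the identity. *)
have GletterP l : Gamma (toM (letter_zmx (cert_f c) (cert_g c) l)).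
  by case: l => -[] [] [] [] [] [] [] [].
have Gword w : Gamma (toM (word_zmx (cert_f c) (cert_g c) w)).
  by elim: w => [|l w IH] //=; rewrite toM_mul; apply: GM.
have Gpow w k : Gamma (toM (power_zmx (cert_f c) (cert_g c) w k)).
  have GX X (j : nat) : Gamma X -> Gamma (X ^+ j).
    by move=> GX; elim: j => [|j IH]; rewrite ?expr0 ?exprS //; apply: GM.
  by case: k => [|k|k] //; rewrite toM_pow; apply: GX.
have Gprod u r : Gamma (toM (certificate_product c u r)).
  rewrite /certificate_product; elim: zip => [|p s IH]; first exact: Gpow.
  by rewrite /= toM_mul; apply: GM.
pose m := (Pos.to_nat (cert_level c))%:Z.
have H_root b : (b < 4)%N ->
    conj_subgroup toJ P Gamma (etransv toJ (basis_e 0) (delta_mx (inord b.+2) 0) m) /\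
    conj_subgroup toJ P Gamma (etransv toJ (basis_f 0) (delta_mx (inord b.+2) 0) m).
  move=> b4; have /allP/(_ b) := rows; rewrite mem_iota b4 => /(_ isT)/andP[/eqP e_b /eqP f_b].
  have b6 : (b.+2 < 6)%N by rewrite !ltnS.
  have mE : m = int_of_Z (Zpos (cert_level c)) by [].
  split; split.
  - apply: etransv_isometry; first exact: toJ_alt.
    by rewrite form_delta toM_mk !inordK //; case: (b) b4 => [|[|[|[|]]]].
  - exists (toM (certificate_product c "" (nth ([::], 0) (cert_rows c) b))) => //.
    by rewrite mE etransv_delta !inordK // -[LHS]toM_mul e_b toM_mul.
  - apply: etransv_isometry; first exact: toJ_alt.
    by rewrite form_delta toM_mk !inordK //; case: (b) b4 => [|[|[|[|]]]].
  exists (toM (certificate_product c (cert_conj c) (nth ([::], 0) (cert_rows c) (b + 4)))) => //.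
  by rewrite mE etransv_delta !inordK // -[LHS]toM_mul f_b toM_mul.
have D_gt0 : (0 < Pos.to_nat (cert_scale c))%N.
  by have := Pos2Nat.is_pos (cert_scale c); lia.
apply: (finitely_covered_lattice toJ_unit D_gt0 POm Ggroup).
apply: (@finite_index_of_root_elements _ _ toJ_alt _ _ _ toJ_basis _ _ m) => //.
- exact: conj_subgroup_group.
- by have := Pos2Nat.is_pos (cert_level c); rewrite /m; lia.
move=> [|[|[|i]]] // _.
  have [ee fe] := H_root 0%N isT; have [ef ff] := H_root 1%N isT.
  by split; [exact: ee | exact: ef | exact: fe | exact: ff].
have [ee fe] := H_root 2%N isT; have [ef ff] := H_root 3%N isT.
by split; [exact: ee | exact: ef | exact: fe | exact: ff].
Qed.

End Soundness.

(* The certificates were found by a search among short words. *)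
Definition certificate1 : certificate := Certificate
  [:: 1; -2; -1; 4; -1; -2; 1]%BZ
  [:: 1; 1; 2; 1; 2; 1; 1]%BZ
  ([:: [:: 0; -2; -1; -3; 4; 5];
      [:: 2; 0; -2; -1; -3; 4];
      [:: 1; 2; 0; -2; -1; -3];
      [:: 3; 1; 2; 0; -2; -1];
      [:: -4; 3; 1; 2; 0; -2];
      [:: -5; -4; 3; 1; 2; 0]])%BZ
  ([:: [:: -1; 0; 0; 0; 0; 0];
      [:: -1; -1; 0; 0; 1; 0];
      [:: 1; -1; 0; 1; -3; -2];
      [:: -1; 1; 0; 0; 0; 1];
      [:: -1; -1; 9; 0; 2; -2];
      [:: 0; -1; 0; 0; 0; 0]])%BZ
  9 1944
  [:: ("aBBabbAA", "aaBBAbbA");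
      ("AAbbABBaaa", "AAbaBBAbaa");
      ("bAbABBaBaa", "aBaBBAbAba");
      ("AAAbbAAABBaB", "aaBBaaabbAba")]%string
  "a"
  [:: ([:: 126; -90; -81; 81], -940248);
      ([:: 8; 8; 18; 0], -187200);
      ([:: 0; -36; -54; 0], -2516832);
      ([:: -36; 0; 0; 0], 0);
      ([:: 72; -36; 162; 162], 41569200);
      ([:: -4; 8; 18; -18], -326736);
      ([:: 18; -18; -27; 81], -2203848);
      ([:: 0; 0; -54; 0], 0)]%BZ.

Definition certificate2 : certificate := Certificate
  [:: 1; -3; 3; -2; 3; -3; 1]%BZ
  [:: 1; 0; 0; 1; 0; 0; 1]%BZ
  ([:: [:: 0; -1; -2; -2; -1; 1];
      [:: 1; 0; -1; -2; -2; -1];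
      [:: 2; 1; 0; -1; -2; -2];
      [:: 2; 2; 1; 0; -1; -2];
      [:: 1; 2; 2; 1; 0; -1];
      [:: -1; 1; 2; 2; 1; 0]])%BZ
  ([:: [:: -1; 0; 0; 0; 0; 0];
      [:: 1; -1; 0; 0; 1; 0];
      [:: -1; 1; 0; 1; -2; 1];
      [:: 1; -1; 1; 0; 1; -2];
      [:: -1; 1; 0; 0; 0; 1];
      [:: 0; -1; 0; 0; 0; 0]])%BZ
  1 18
  [:: ("ABAABBABB", "bbabbaaba");
      ("bbaababba", "ABBABAABB");
      ("AABABBABB", "bbabbabaa");
      ("baabbabba", "ABBABBAAB")]%string
  "a"
  [:: ([:: -2; 2; -1; 2], 432);
      ([:: -1; 2; -2; 1], -312);
      ([:: 1; -1; 1; 0], -24);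
      ([:: 1; -1; 0; -1], 336);
      ([:: -1; 2; -2; 1], -312);
      ([:: 1; 1; -2; 0], -216);
      ([:: -1; 0; 1; 0], 120);
      ([:: 1; -1; 1; 0], -24)]%BZ.

Definition certificate3 : certificate := Certificate
  [:: 1; -2; 3; -4; 3; -2; 1]%BZ
  [:: 1; 1; 0; -1; 0; 1; 1]%BZ
  ([:: [:: 0; 0; -1; -1; 0; -1];
      [:: 0; 0; 0; -1; -1; 0];
      [:: 1; 0; 0; 0; -1; -1];
      [:: 1; 1; 0; 0; 0; -1];
      [:: 0; 1; 1; 0; 0; 0];
      [:: 1; 0; 1; 1; 0; 0]])%BZ
  ([:: [:: -1; -1; 0; 1; 0; 0];
      [:: 1; 2; 0; 0; 0; 1];
      [:: -1; -3; 1; 0; -1; 0];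
      [:: 1; 2; 0; 0; 1; 0];
      [:: -1; -2; 0; 0; 0; 0];
      [:: 0; 1; 0; 0; 0; 0]])%BZ
  1 90
  [:: ("aaaa", "AAAA");
      ("aaaBaa", "aaaBAAAAAA");
      ("aBAAAbaa", "bAAABaaa");
      ("aaBAAAba", "abAAABaa");
      ("aaabAAAAAAA", "AAAAAba")]%string
  "A"
  [:: ([:: 0; -3; 0; -4; 1], 5304);
      ([:: 0; 6; -4; 5; -3], -6096);
      ([:: 0; 6; 0; 3; -2], 8184);
      ([:: 0; 3; -5; 4; -1], -7680);
      ([:: -5; 2; 1; -2; 0], 672);
      ([:: -5; 2; -4; 3; 0], -2568);
      ([:: 5; 1; -2; 4; 0], 0);
      ([:: 5; -2; -1; -3; 0], 696)]%BZ.

Definition certificate4 : certificate := Certificate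
  [:: 1; -2; 0; 2; 0; -2; 1]%BZ
  [:: 1; 1; 3; 2; 3; 1; 1]%BZ
  ([:: [:: 0; -1; 0; -1; 2; 3];
      [:: 1; 0; -1; 0; -1; 2];
      [:: 0; 1; 0; -1; 0; -1];
      [:: 1; 0; 1; 0; -1; 0];
      [:: -2; 1; 0; 1; 0; -1];
      [:: -3; -2; 1; 0; 1; 0]])%BZ
  ([:: [:: -1; 0; 0; 0; 0; 0];
      [:: -1; -1; 0; 0; 0; 1];
      [:: 0; -1; 0; 1; 2; 0];
      [:: -1; 0; 4; 0; 0; 1];
      [:: -1; -1; 0; 0; 2; 0];
      [:: 0; -1; 0; 0; 0; 0]])%BZ
  4 216
  [:: ("bABBaa", "aBBAba");
      ("aBBabbAA", "bAbbABBaaB");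
      ("bAbABBaBaa", "aBaBBAbAba");
      ("AAbbABBaaa", "ABaBBabbAAba");
      ("AAbaaaaBBABBaa", "aBAAAAbbabbA");
      ("aBAbABBabbAAba", "bAAbAbABBaaa")]%string
  "a"
  [:: ([:: 0; 0; 6; 0; -4; 0], 0);
      ([:: 0; 1; 1; 0; 0; -1], 1296);
      ([:: 0; 4; 0; 0; 0; 0], 0);
      ([:: 0; 0; 3; 0; 0; 0], 0);
      ([:: 12; 4; 0; 4; 0; 0], -31392);
      ([:: 3; 0; 0; 0; 1; 0], 0);
      ([:: 12; 0; 0; 0; 0; 0], 0);
      ([:: 0; 0; 0; 2; 0; 0], 0)]%BZ.

(** * Characteristic polynomials of the four pairs *)

Lemma map_zpoly_nil (K : nzRingType) : map_poly intr (zpoly [::]) = 0 :> {poly K}.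
Proof. by rewrite map_poly0. Qed.

Lemma map_zpoly_cons (K : nzRingType) c (s : seq Z) :
  map_poly intr (zpoly (c :: s)) =
    map_poly intr (zpoly s) * 'X + (int_of_Z c)%:~R :> {poly K}.
Proof.
by rewrite /zpoly /= cons_poly_def rmorphD rmorphM /= map_polyX map_polyC /= rmorph_int.
Qed.

(** Coefficients are evaluated to numerals for [ring], while the linear factors stay folded and can
    be matched with the cyclotomic identities. *)
Ltac expand_param_poly :=
  rewrite param_poly_prod /= !big_cons big_nil mulr1 !map_zpoly_cons map_zpoly_nil;
  repeat match goal with
  | |- context [int_of_Z ?z] =>
      let v := eval vm_compute in (int_of_Z z) in change (int_of_Z z) with v
  end.

Section CharacteristicPolynomials.

Variable R : realType.

Lemma param_poly1f :
  param_poly R (in_tuple [:: 0; 0; 0; 0; 1 / 2; 1 / 2]) =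
    map_poly intr (zpoly (cert_f certificate1)).
Proof.
expand_param_poly; rewrite root_factor0 root_factor_half.
by ring.
Qed.

Lemma param_poly1g :
  param_poly R (in_tuple [:: 1 / 3; 1 / 3; 2 / 3; 2 / 3; 1 / 6; 5 / 6]) =
    map_poly intr (zpoly (cert_g certificate1)).
Proof.
have := cyclotomic_poly3 R; have := cyclotomic_poly6 R; expand_param_poly.
by move=> ab cd; ring: ab cd.
Qed.

Lemma param_poly2f :
  param_poly R (in_tuple [:: 0; 0; 0; 0; 1 / 3; 2 / 3]) =
    map_poly intr (zpoly (cert_f certificate2)).
Proof.
have := cyclotomic_poly3 R; expand_param_poly; rewrite root_factor0.
by move=> ab; ring: ab.
Qed.

Lemma param_poly2g :
  param_poly R (in_tuple [:: 1 / 9; 2 / 9; 4 / 9; 5 / 9; 7 / 9; 8 / 9]) =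
    map_poly intr (zpoly (cert_g certificate2)).
Proof.
have := cyclotomic_poly9 R; expand_param_poly => y9.
rewrite [RHS](_ : _ = 'X^6 + 'X^3 + 1); last by ring.
by rewrite -y9; ring.
Qed.

Lemma param_poly3f :
  param_poly R (in_tuple [:: 0; 0; 1 / 4; 1 / 4; 3 / 4; 3 / 4]) =
    map_poly intr (zpoly (cert_f certificate3)).
Proof.
have := cyclotomic_poly4 R; expand_param_poly; rewrite root_factor0.
by move=> ab; ring: ab.
Qed.

Lemma param_poly3g :
  param_poly R (in_tuple [:: 1 / 3; 2 / 3; 1 / 12; 5 / 12; 7 / 12; 11 / 12]) =
    map_poly intr (zpoly (cert_g certificate3)).
Proof.
have := cyclotomic_poly3 R; have := cyclotomic_poly12 R; expand_param_poly.
by move=> cdef ab; ring: ab cdef.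
Qed.

Lemma param_poly4f :
  param_poly R (in_tuple [:: 0; 0; 1 / 12; 5 / 12; 7 / 12; 11 / 12]) =
    map_poly intr (zpoly (cert_f certificate4)).
Proof.
have := cyclotomic_poly12 R; expand_param_poly; rewrite root_factor0.
by move=> cdef; ring: cdef.
Qed.

Lemma param_poly4g :
  param_poly R (in_tuple [:: 1 / 3; 2 / 3; 1 / 4; 3 / 4; 1 / 4; 3 / 4]) =
    map_poly intr (zpoly (cert_g certificate4)).
Proof.
have := cyclotomic_poly3 R; have := cyclotomic_poly4 R; expand_param_poly.
by move=> cd ab; ring: ab cd.
Qed.

End CharacteristicPolynomials.

Theorem theorem2 (R : realType) :
  [/\ arithmetic (hypergeometric_group R (n := 6)
        (in_tuple [:: 0; 0; 0; 0; 1 / 2; 1 / 2])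
        (in_tuple [:: 1 / 3; 1 / 3; 2 / 3; 2 / 3; 1 / 6; 5 / 6])),
      arithmetic (hypergeometric_group R (n := 6)
        (in_tuple [:: 0; 0; 0; 0; 1 / 3; 2 / 3])
        (in_tuple [:: 1 / 9; 2 / 9; 4 / 9; 5 / 9; 7 / 9; 8 / 9])),
      arithmetic (hypergeometric_group R (n := 6)
        (in_tuple [:: 0; 0; 1 / 4; 1 / 4; 3 / 4; 3 / 4])
        (in_tuple [:: 1 / 3; 2 / 3; 1 / 12; 5 / 12; 7 / 12; 11 / 12])) &
      arithmetic (hypergeometric_group R (n := 6)
        (in_tuple [:: 0; 0; 1 / 12; 5 / 12; 7 / 12; 11 / 12])
        (in_tuple [:: 1 / 3; 2 / 3; 1 / 4; 3 / 4; 1 / 4; 3 / 4]))].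
Proof.
split.
- by apply: (certificate_sound (param_poly1f R) (param_poly1g R)); vm_compute.
- by apply: (certificate_sound (param_poly2f R) (param_poly2g R)); vm_compute.
- by apply: (certificate_sound (param_poly3f R) (param_poly3g R)); vm_compute.
- by apply: (certificate_sound (param_poly4f R) (param_poly4g R)); vm_compute.
Qed.
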